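(* There is a universal constant $c>0$ such that for all integers $d,\tau\ge1$ and reals $\mu>0$, $\sigma_1>0$, $\sigma_2>0$ the following holds for all sufficiently small $\varepsilon>0$. (One-point.) For any (possibly randomized) algorithm with one-point feedback there exists a one-point instance with parameters $(d,\tau,\mu,\sigma_1)$ on which, in order to output a point $x^N$ with $\mathbb{E}\|x^N-x^*\|^2\le\varepsilon$, the algorithm needs at least $$c\,\frac{d(d+\tau)\sigma_1^2}{\mu^2\varepsilon^2}\quad\text{one-point oracle calls.}$$ (Two-point.) For any (possibly randomized) algorithm with two-point feedback there exists a two-point instance with parameters $(d,\tau,\mu,\sigma_2)$ on which, in order to output a point $x^N$ with $\mathbb{E}\|x^N-x^*\|^2\le\varepsilon$, the algorithm needs at least $$c\,\frac{(d+\tau)\sigma_2^2}{\mu^2\varepsilon}\quad\text{two-point oracle calls.}$$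
   Context: Norms are Euclidean. An instance consists of a complete separable metric space $\mathsf{Z}$ with its Borel $\sigma$-algebra, a stationary Markov chain $\{Z_i\}$ on it with kernel $\mathrm{Q}$ and unique invariant distribution $\pi$ satisfying $\sup_{z,z'}\frac12\|\mathrm{Q}^k(z,\cdot)-\mathrm{Q}^k(z',\cdot)\|_{\mathsf{TV}}\le(1/4)^{\lfloor k/\tau\rfloor}$ for all $k\in\mathbb{N}$, and a function $F:\mathbb{R}^d\times\mathsf{Z}\to\mathbb{R}$ with $f(x)=\mathbb{E}_{Z\sim\pi}[F(x,Z)]$; $x^*$ denotes the minimizer of $f$. One-point instance with parameters $(d,\tau,\mu,\sigma_1)$: $f$ is differentiable with $L$-Lipschitz gradient for some $L>0$; $f$ is $\mu$-strongly convex, i.e. $\frac\mu2\|x-y\|^2\le f(x)-f(y)-\langle\nabla f(y),x-y\rangle$ for all $x,y$; and $\mathbb{E}_\pi|F(x,Z)-f(x)|^2\le\sigma_1^2$ for all $x$. Two-point instance with parameters $(d,\tau,\mu,\sigma_2)$: for some $L>0$, for every $Z\in\mathsf{Z}$ the function $F(\cdot,Z)$ is differentiable with $L$-Lipschitz gradient; $f$ is $\mu$-strongly convex, i.e. $\frac\mu2\|x-y\|^2\le f(x)-f(y)-\langle\nabla f(y),x-y\rangle$ for all $x,y$; $\mathbb{E}_\pi[\nabla F(x,Z)]=\nabla f(x)$ and $\mathbb{E}_\pi\|\nabla F(x,Z)-\nabla f(x)\|^2\le\sigma_2^2$ for all $x$. One-point feedback: the $k$-th oracle call, at a point $x_k$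 chosen by the algorithm from its previous observations and internal randomness, returns $F(x_k,Z_k)$. Two-point feedback: the $k$-th call, at a pair $x_k,y_k$ so chosen, returns $F(x_k,Z_k)$ and $F(y_k,Z_k)$. *)

(* Defs.v *)
From HB Require Import structures.
From mathcomp Require Import all_boot all_order all_algebra.
From mathcomp Require Import all_classical all_reals all_analysis.
Set Implicit Arguments.
Unset Strict Implicit.
Unset Printing Implicit Defensive.
Import Order.TTheory GRing.Theory Num.Theory.
Import numFieldTopology.Exports numFieldNormedType.Exports.
Local Open Scope classical_set_scope.
Local Open Scope ring_scope.

(* The library norm on ['rV[R]_d] is the max norm, so the Euclidean structure is
   spelled out; both norms induce the same topology, hence the same notion of
   differentiability and the same Borel sets. *)
Definition dot (R : realType) (d : nat) (x y : 'rV[R]_d) : R :=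
  \sum_(i < d) x 0 i * y 0 i.

Definition enorm (R : realType) (d : nat) (x : 'rV[R]_d) : R :=
  Num.sqrt (dot x x).

Definition grad (R : realType) (d : nat) (g : 'rV[R]_d -> R) (x : 'rV[R]_d) :
    'rV[R]_d :=
  \row_(i < d) 'D_(delta_mx 0 i : 'rV[R]_d) g x.

Definition lipschitz_gradient (R : realType) (d : nat) (L : R)
    (g : 'rV[R]_d -> R) : Prop :=
  (forall x, differentiable g x) /\
  (forall x y, enorm (grad g x - grad g y) <= L * enorm (x - y)).

Definition strongly_convex (R : realType) (d : nat) (mu : R)
    (g : 'rV[R]_d -> R) : Prop :=
  (forall x, differentiable g x) /\
  (forall x y, mu / 2 * enorm (x - y) ^+ 2 <=
               g x - g y - dot (grad g y) (x - y)).

Definition is_minimizer (R : realType) (d : nat) (g : 'rV[R]_d -> R)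
    (xs : 'rV[R]_d) : Prop :=
  forall x, g xs <= g x.

(* [g_sigma_algebraType] is an alias of its carrier, so a [borel T] may be used
   as a [T] and conversely. *)
Notation borel T := (g_sigma_algebraType (@open T)).

#[short(type="completeMetricType")]
HB.structure Definition CompleteMetric (R : numDomainType) :=
  { T of Complete T & Metric R T }.

Definition separable_space (T : topologicalType) : Prop :=
  exists D : set T, countable D /\ dense D.

(* Total mass of the variation of [nu]; independent of the Hahn decomposition
   chosen. *)
Definition tv_norm (d : measure_display) (T : measurableType d) (R : realType)
    (nu : {charge set T -> \bar R}) : \bar R :=
  let P := cid (Hahn_decomposition nu) in
  let N := cid (svalP P) in
  charge_variation (svalP N) [set: T].

Definition measure_diff (d : measure_display) (T : measurableType d)
    (R : realType) (m1 m2 : {finite_measure set T -> \bar R}) :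
    {charge set T -> \bar R} :=
  cadd (charge_of_finite_measure m1) (copp (charge_of_finite_measure m2)).

Fixpoint kernel_iter (d : measure_display) (T : measurableType d)
    (R : realType) (Q : R.-pker T ~> T) (k : nat) : R.-spker T ~> T :=
  match k with
  | 0 => kdirac (@measurable_id _ T [set: T])
  | k'.+1 => mkcomp_noparam Q (kernel_iter Q k')
  end.

(* [k x] with its structure of finite measure, which the library does not attach
   to the values of a kernel. *)
Definition kernel_at (d : measure_display) (T : measurableType d)
    (R : realType) (k : R.-spker T ~> T) (x : T) : set T -> \bar R := k x.

HB.instance Definition _ (d : measure_display) (T : measurableType d)
    (R : realType) (k : R.-spker T ~> T) (x : T) :=
  Measure.on (kernel_at k x).

Lemma kernel_at_le1 (d : measure_display) (T : measurableType d)
    (R : realType) (k : R.-spker T ~> T) (x : T) :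
  (kernel_at k x [set: T] <= 1)%E.
Proof. exact: sprob_kernel_le1. Qed.

HB.instance Definition _ (d : measure_display) (T : measurableType d)
    (R : realType) (k : R.-spker T ~> T) (x : T) :=
  Measure_isSubProbability.Build _ _ _ (kernel_at k x) (kernel_at_le1 k x).

Definition invariant_law (d : measure_display) (T : measurableType d)
    (R : realType) (Q : R.-pker T ~> T) (m : probability T R) : Prop :=
  forall A, measurable A -> (\int[m]_z Q z A = m A)%E.

Record markov_source (R : realType) := MarkovSource {
  state : completeMetricType R;
  state_separable : separable_space state;
  transition : R.-pker borel state ~> borel state;
  stat_law : probability (borel state) R;
  stat_law_invariant : invariant_law transition stat_law;
  stat_law_unique : forall m : probability (borel state) R,
    invariant_law transition m ->
    forall A, measurable A -> m A = stat_law A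
}.

Definition mixing (R : realType) (tau : nat) (M : markov_source R) : Prop :=
  forall (k : nat) (z z' : state M),
    ((2^-1)%:E * tv_norm (measure_diff (kernel_at (kernel_iter (transition M) k) z)
                                       (kernel_at (kernel_iter (transition M) k) z'))
     <= ((4^-1) ^+ (k %/ tau))%:E)%E.

Definition objective (R : realType) (d : nat) (M : markov_source R)
    (F : 'rV[R]_d -> state M -> R) (x : 'rV[R]_d) : R :=
  \int[stat_law M]_z F x z.

(* Well-posedness of [objective] and of the adaptively queried values. *)
Record well_posed (R : realType) (d : nat) (M : markov_source R)
    (F : 'rV[R]_d -> state M -> R) : Prop := WellPosed {
  wp_measurable : measurable_fun setT
    (fun p : borel 'rV[R]_d * borel (state M) => F p.1 p.2);
  wp_integrable : forall x,
    (stat_law M).-integrable setT (fun z => (F x z)%:E)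
}.

Record one_point_instance (R : realType) (d tau : nat) (mu sigma1 : R)
    (M : markov_source R) (F : 'rV[R]_d -> state M -> R) : Prop :=
  OnePointInstance {
  op_mixing : mixing tau M;
  op_well_posed : well_posed F;
  op_smooth : exists2 L : R, 0 < L & lipschitz_gradient L (objective F);
  op_convex : strongly_convex mu (objective F);
  op_variance : forall x,
    (\int[stat_law M]_z (`|F x z - objective F x| ^+ 2)%:E
     <= (sigma1 ^+ 2)%:E)%E
}.

Record two_point_instance (R : realType) (d tau : nat) (mu sigma2 : R)
    (M : markov_source R) (F : 'rV[R]_d -> state M -> R) : Prop :=
  TwoPointInstance {
  tp_mixing : mixing tau M;
  tp_well_posed : well_posed F;
  tp_smooth : exists2 L : R, 0 < L &
    forall z, lipschitz_gradient L (F ^~ z);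
  tp_convex : strongly_convex mu (objective F);
  tp_grad_integrable : forall x i,
    (stat_law M).-integrable setT (fun z => (grad (F ^~ z) x 0 i)%:E);
  tp_unbiased : forall x,
    \row_(i < d) (\int[stat_law M]_z grad (F ^~ z) x 0 i)
    = grad (objective F) x;
  tp_variance : forall x,
    (\int[stat_law M]_z
       (enorm (grad (F ^~ z) x - grad (objective F) x) ^+ 2)%:E
     <= (sigma2 ^+ 2)%:E)%E
}.

(* A randomized algorithm with queries in [X] and observations in [O]: all its
   randomness [u] is drawn at the start from an arbitrary probability space.
   After the observations [h], oldest first, [query u h] is the next query and
   [output u h] the point returned if no further call is made; its own past
   queries are functions of [u] and [h]. *)
Record algorithm (R : realType) (d : nat) (dX dO : measure_display)
    (X : measurableType dX) (O : measurableType dO) := Algorithm {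
  rand_display : measure_display;
  rand : measurableType rand_display;
  rand_law : probability rand R;
  query : rand -> seq O -> X;
  output : rand -> seq O -> 'rV[R]_d;
  query_measurable : forall n,
    measurable_fun setT (fun p : rand * n.-tuple O => query p.1 p.2);
  output_measurable : forall n,
    measurable_fun setT
      (fun p : rand * n.-tuple O => output p.1 p.2 : borel 'rV[R]_d)
}.

Definition one_point_algorithm (R : realType) (d : nat) :=
  algorithm R d (borel 'rV[R]_d) R.

Definition two_point_algorithm (R : realType) (d : nat) :=
  algorithm R d (borel 'rV[R]_d * borel 'rV[R]_d)%type (R * R)%type.

(* The observations made from the history [h] on, when the successive states of
   the chain are [zs]. *)
Fixpoint observations (R : realType) (d : nat) (dX dO : measure_display)
    (X : measurableType dX) (O : measurableType dO) (A : algorithm R d X O)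
    (S : Type) (oracle : X -> S -> O) (u : rand A) (h : seq O) (zs : seq S) :
    seq O :=
  match zs with
  | [::] => h
  | z :: zs' => observations oracle u (rcons h (oracle (query u h) z)) zs'
  end.

(* Expectation of [g (Z_1, ..., Z_n)] for the Markov chain with kernel [Q] whose
   first state [Z_1] has law [m]. *)
Fixpoint path_expectation (d : measure_display) (T : measurableType d)
    (R : realType) (Q : R.-pker T ~> T) (m : {measure set T -> \bar R})
    (n : nat) (g : seq T -> \bar R) : \bar R :=
  match n with
  | 0 => g [::]
  | n'.+1 => (\int[m]_z path_expectation Q (Q z) n' (fun s => g (z :: s)))%E
  end.

(* Expected squared distance to [xs] of the output after [N] oracle calls; the
   internal randomness is independent of the stationary chain. *)
Definition mean_square_error (R : realType) (d : nat) (dX dO : measure_display)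
    (X : measurableType dX) (O : measurableType dO) (A : algorithm R d X O)
    (M : markov_source R) (oracle : X -> state M -> O) (N : nat)
    (xs : 'rV[R]_d) : \bar R :=
  path_expectation (transition M) (stat_law M) N (fun zs =>
    (\int[rand_law A]_u
       (enorm (output u (observations oracle u [::] zs) - xs) ^+ 2)%:E)%E).

Definition one_point_error (R : realType) (d : nat)
    (A : one_point_algorithm R d) (M : markov_source R)
    (F : 'rV[R]_d -> state M -> R) (N : nat) (xs : 'rV[R]_d) : \bar R :=
  mean_square_error A (fun x z => F x z) N xs.

Definition two_point_error (R : realType) (d : nat)
    (A : two_point_algorithm R d) (M : markov_source R)
    (F : 'rV[R]_d -> state M -> R) (N : nat) (xs : 'rV[R]_d) : \bar R :=
  mean_square_error A (fun xy z => (F xy.1 z, F xy.2 z)) N xs.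

(* Main.v *)
Require Import Defs.
From HB Require Import structures.
From mathcomp Require Import all_boot all_order all_algebra.
From mathcomp Require Import all_classical all_reals all_analysis.
From mathcomp Require Import measurable_realfun ring lra.
Set Implicit Arguments.
Unset Strict Implicit.
Unset Printing Implicit Defensive.
Import Order.TTheory GRing.Theory Num.Theory.
Import numFieldTopology.Exports numFieldNormedType.Exports.
Local Open Scope classical_set_scope.
Local Open Scope ring_scope.

(** Both lower bounds come from one adversary. A vector v of d signs is hidden in
    the objective
      f_v(x) = sum_i (mu x_i^2 - v_i eta(x_i)),
    which is mu-strongly convex with minimiser a v, where a^2 d = 5 eps. An
    output that misses a sign pays a^2 for it, so an algorithm that gets a
    quarter of the signs wrong on average has mean square error at least
    a^2 d / 4 > eps. The oracle hides the signs behind Gaussian noise: the state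
    z is a standard Gaussian vector and F_v(x, z) = f_v(x) + <c(x), z>.

    Flipping v_i changes f_v(x) by 2 v_i eta(x_i), and the same change results
    from translating z by any t_i(x) with <c(x), t_i(x)> = - 2 v_i eta(x_i). Thus
    a run under v sees what a run under the flipped vector would see along
    translated noise, and the Cameron-Martin formula ([cameron_martin]) prices
    the translation: its likelihood ratio L has second moment exp |t_i(x)|^2.

    The two runs are compared without information divergences. For psi in
    [0, 1] and every lam > 0 one has psi <= lam / 2 + psi / (2 lam), and lam may
    be chosen anew at each step, as a function of the translated noise; the
    choice lam' = r lam L turns an inequality about what follows the step into
    the same inequality before it, provided that a discount r with
    r^2 (1 - w + w exp |t_i(x)|^2) <= 1 is paid, where w is the probability that
    the state is fresh ([shift_step_fresh], [shift_step_lazy]). With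
    r = 1 - w |t_i(x)|^2 this gives, for the event that sign i is guessed right,
      E_v [prod_k r_k ; right] <= 1/4 + E_(flipped v) [right]
    ([compare_runs]). The product is at least 1 - sum_k w_k |t_i(x_k)|^2 along
    every run, and summed over i the losses are at most (1 + c N) Q, where c is
    the refresh probability of the chain and Q bounds sum_i |t_i(x)|^2 over all
    queries x. As long as (1 + c N) Q <= d / 4, averaging over all v and i yields
    a v with error at least a^2 d / 4 ([assouad]).

    The chain keeps its state with probability b and otherwise draws a fresh
    one. Independent states (b = 0) serve when tau <= d; when tau > d the choice
    1 - b = 3 / (tau + 3) still mixes at the required speed and makes only one
    call in about tau / 3 informative. A state that persists has to be
    translated by the same vector at all calls, so t_i must then be constant in
    x; this is where the four regimes differ.
    - One point. eta is bounded by h = 9 mu a^2. With independent states all the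
      noise is put on one direction and Q is of order d h^2 / sigma^2; with the
      lazy chain the noise is sum_i eta(x_i) z_i up to scale, the translations
      are constant and Q is of order d^2 h^2 / sigma^2.
    - Two points. eta is linear with slope of order mu a, and the noise is
      <x, z> up to scale. With independent states t_i is the projection of the
      i-th unit vector on the plane spanned by the two query points, and
      the squared norms of the d projections sum to at most 2, so Q is of order
      d mu^2 a^2 / sigma^2; with the lazy chain t_i is parallel to the i-th unit
      vector and Q is d times larger. *)

(** * Measurable inversion and inner products *)

Lemma measurable_inv (R : realType) : measurable_fun setT (GRing.inv : R -> R).
Proof.
rewrite -(setUv [set (0 : R)]).
apply/measurable_funU => //; first exact: measurableC.
split; first exact: measurable_fun_set1.
apply: open_continuous_measurable_fun.
  rewrite openC; apply: accessible_closed_set1; apply: hausdorff_accessible.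
  exact: Rhausdorff.
by move=> x; rewrite inE => /eqP x0; apply: inv_continuous.
Qed.

Section InnerProduct.
Variables (R : realType) (n : nat).
Implicit Types x y z : 'rV[R]_n.

Lemma dotC x y : dot x y = dot y x.
Proof. by apply: eq_bigr => i _; rewrite mulrC. Qed.

Lemma dotDr x y z : dot x (y + z) = dot x y + dot x z.
Proof. by rewrite /dot -big_split; apply: eq_bigr => i _; rewrite mxE mulrDr. Qed.

Lemma dotDl x y z : dot (x + y) z = dot x z + dot y z.
Proof. by rewrite dotC dotDr dotC (dotC z). Qed.

Lemma dotZl (a : R) x y : dot (a *: x) y = a * dot x y.
Proof. by rewrite /dot mulr_sumr; apply: eq_bigr => i _; rewrite mxE mulrA. Qed.

Lemma dotZr (a : R) x y : dot x (a *: y) = a * dot x y.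
Proof. by rewrite dotC dotZl dotC. Qed.

Lemma dotNl x y : dot (- x) y = - dot x y.
Proof. by rewrite -scaleN1r dotZl mulN1r. Qed.

Lemma dotNN x : dot (- x) (- x) = dot x x.
Proof. by rewrite dotNl dotC dotNl opprK. Qed.

Lemma dot0l x : dot 0 x = 0.
Proof. by rewrite /dot big1// => i _; rewrite mxE mul0r. Qed.

Lemma dot_ge0 x : 0 <= dot x x.
Proof. by apply: sumr_ge0 => i _; rewrite -expr2 sqr_ge0. Qed.

Lemma dot_eq0 x : dot x x = 0 -> x = 0.
Proof.
move=> x0; apply/rowP => i; rewrite mxE; apply/eqP; rewrite -sqrf_eq0 expr2; apply/eqP.
have /psumr_eq0P : \sum_(i < n) x 0 i * x 0 i = 0 by exact: x0.
by apply => // j _; rewrite -expr2 sqr_ge0.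
Qed.

Lemma dotBE x y : dot (y - x) (y - x) = \sum_i (y 0 i - x 0 i) ^+ 2.
Proof. by apply: eq_bigr => i _; rewrite !mxE expr2. Qed.

Lemma enorm_sqr x : enorm x ^+ 2 = dot x x.
Proof. by rewrite /enorm sqr_sqrtr// dot_ge0. Qed.

Definition unit_row (i : 'I_n) : 'rV[R]_n := delta_mx 0 i.

Lemma dot_unitl i x : dot (unit_row i) x = x 0 i.
Proof.
rewrite /dot (bigD1 i)//= big1 ?addr0; first by rewrite mxE !eqxx mul1r.
by move=> j ji; rewrite mxE eqxx (negbTE ji) mul0r.
Qed.

Lemma unit_row_dot i : dot (unit_row i) (unit_row i) = 1.
Proof. by rewrite dot_unitl mxE !eqxx. Qed.

Lemma dot_unitr i x : dot x (unit_row i) = x 0 i.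
Proof. by rewrite dotC dot_unitl. Qed.

End InnerProduct.

(** * The lazy chain and its mixing time *)

Section Space.
Variables (R : realType) (n : nat).

Let mdist (x y : 'rV[R]_n.+1) : R := `|y - x|.

Let mdist_ge0 x y : 0 <= mdist x y.
Proof. exact: normr_ge0. Qed.

Let mdist_positivity x y : mdist x y = 0 -> x = y.
Proof. by move/normr0_eq0/eqP; rewrite subr_eq0 => /eqP. Qed.

Let ballEmdist (x : 'rV[R]_n.+1) (e : R) : ball x e = [set y | mdist x y < e].
Proof.
rewrite mx_norm_ball.
by apply/seteqP; split => y; rewrite /mdist /ball_ /= distrC.
Qed.

HB.instance Definition _ :=
  @PseudoMetric_isMetric.Build R 'rV[R]_n.+1 mdist mdist_ge0 mdist_positivity ballEmdist.
End Space.

(** The distance of the metric structure is that of the max norm, whose balls are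
    those already attached to row vectors. *)
Definition space (R : realType) n : completeMetricType R := 'rV[R]_n.+1.

Lemma rV_separable (R : realType) n : separable_space 'rV[R]_n.+1.
Proof.
exists (range (fun f : {ffun 'I_n.+1 -> rat} => \row_i ratr (f i) : 'rV[R]_n.+1)).
split; first by apply: card_le_trans (card_image_le _ _) _; exact: countableP.
move=> O [x Ox] oO.
have /nbhs_ballP[e /= e0 xO] : nbhs x O by exact: open_nbhs_nbhs.
have /choice[q qP] : forall i, exists q : rat, `|x 0 i - ratr q| < e.
  move=> i; have /rat_in_itvoo[q] : x 0 i - e < x 0 i + e by lra.
  rewrite in_itv/= => /andP[q1 q2]; exists q; rewrite ltr_norml; lra.
exists (\row_i ratr (q i)); split.
  apply: xO; split => // i j; rewrite mxE (ord1 i); exact: qP.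
exists (finfun q) => //; apply/rowP => i; by rewrite !mxE ffunE.
Qed.

Lemma integral_prob_cst (R : realType) (d : measure_display) (T : measurableType d)
  (pi : probability T R) (e : \bar R) : (\int[pi]_y e = e)%E.
Proof. by rewrite integral_cst//= probability_setT mule1. Qed.

(** The total variation is the sum of the values of the charge on the two halves
    of a Hahn decomposition, up to sign. *)
Lemma tv_norm_le (R : realType) (d : measure_display) (T : measurableType d)
    (nu : {charge set T -> \bar R}) (r : R) :
  (forall A, measurable A -> (`|nu A| <= r%:E)%E) -> (tv_norm nu <= (2 * r)%:E)%E.
Proof.
move=> nur; rewrite /tv_norm; set P := sval (cid _); case: (cid _) => N nuPN /=.
have [[mP _] [mN _] _ _] := nuPN.
rewrite /charge_variation mulr2n mulrDl mul1r EFinD leeD//.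
  rewrite jordan_posE cjordan_posE /crestr0 mem_set//= /crestr setTI.
  exact: le_trans (lee_abs _) (nur _ mP).
rewrite jordan_negE cjordan_negE /crestr0 mem_set//= /crestr setTI.
by rewrite (le_trans (lee_abs _))// abseN; exact: nur.
Qed.

Section Lazy.
Variables (R : realType) (d : measure_display) (T : measurableType d).
Variables (pi : probability T R) (b c : {nonneg R}) (bc1 : b%:num + c%:num = 1).

(** The law of the next state of a chain that stays at x with probability b and
    draws a fresh state from pi with probability c. The proof of b + c = 1 is an
    argument so that the structure of probability kernel can be attached to the
    function itself. *)
Definition lazy_measure of b%:num + c%:num = 1 := fun (x : T) =>
  measure_add (mscale b (dirac x)) (mscale c pi) : {measure set T -> \bar R}.
Arguments lazy_measure : simpl never.
Notation lazy := (lazy_measure bc1).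

Lemma lazyE x (A : set T) : lazy x A = (b%:num%:E * \d_x A + c%:num%:E * pi A)%E.
Proof. by rewrite /lazy_measure /= -/(measure_add _ _) measure_addE. Qed.

Let lazy_meas (U : set T) : measurable U -> measurable_fun [set: T] (lazy ^~ U).
Proof.
move=> mU; rewrite (_ : (fun _ => _) = fun x => (b%:num%:E * (\1_U x)%:E + c%:num%:E * pi U)%E).
  apply: emeasurable_funD => //; apply: measurable_funeM.
  by apply/measurable_EFinP; exact: measurable_indic.
by apply/funext => x; rewrite lazyE diracE indicE.
Qed.

HB.instance Definition _ := @isKernel.Build _ _ T T R lazy lazy_meas.

Let lazy_prob x : lazy x [set: T] = 1%E.
Proof. by rewrite lazyE diracT probability_setT !mule1 -EFinD bc1. Qed.

HB.instance Definition _ := @Kernel_isProbability.Build _ _ T T R lazy lazy_prob.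

Lemma integral_lazy (f : T -> \bar R) x : (forall y, (0 <= f y)%E) ->
  measurable_fun setT f ->
  (\int[lazy x]_y f y = b%:num%:E * f x + c%:num%:E * \int[pi]_y f y)%E.
Proof.
move=> f0 mf; rewrite /lazy_measure ge0_integral_measure_add//.
by rewrite !ge0_integral_mscale// integral_dirac// diracT mul1e.
Qed.

Definition lazy_kernel : R.-pker T ~> T := lazy.

Lemma integral_lazy_set (m : probability T R) (A : set T) : measurable A ->
  (\int[m]_x lazy x A = b%:num%:E * m A + c%:num%:E * pi A)%E.
Proof.
move=> mA; under eq_integral do rewrite lazyE diracE -[(_ \in A)%:R]/(\1_A _).
have m1 : measurable_fun setT (fun y => (\1_A y)%:E : \bar R).
  by apply/measurable_EFinP; exact: measurable_indic.
have i0 y : setT y -> (0 <= b%:num%:E * (\1_A y)%:E :> \bar R)%E.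
  by move=> _; rewrite mule_ge0// lee_fin.
have p0 y : [set: T] y -> (0 <= c%:num%:E * pi A :> \bar R)%E.
  by move=> _; rewrite mule_ge0.
rewrite ge0_integralD//; last exact: measurable_funeM.
rewrite integral_prob_cst; congr (_ + _)%E.
rewrite ge0_integralZl_EFin//.
by rewrite integral_indic// setIT.
Qed.

Lemma lazy_invariant : invariant_law lazy_kernel pi.
Proof.
move=> A mA; rewrite [LHS](integral_lazy_set _ mA) -ge0_muleDl//.
by rewrite -EFinD bc1 mul1e.
Qed.

(** An invariant m satisfies m = b m + c pi, that is c m = c pi. *)
Lemma lazy_invariant_unique (m : probability T R) : 0 < c%:num ->
  invariant_law lazy_kernel m -> forall A, measurable A -> m A = pi A.
Proof.
move=> c0 mi A mA; have := mi A mA; rewrite [LHS](integral_lazy_set _ mA).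
rewrite -(@fineK _ (m A)) ?fin_num_measure// -(@fineK _ (pi A)) ?fin_num_measure//.
rewrite -!(EFinM, EFinD) => -[] /eqP; rewrite -subr_eq0.
have -> : b%:num = 1 - c%:num by rewrite -bc1 addrK.
rewrite (_ : _ - _ = c%:num * (fine (pi A) - fine (m A))); last by ring.
by rewrite mulf_eq0 gt_eqF//= subr_eq0 => /eqP ->.
Qed.

(** In k steps the chain has either never moved, or been refreshed at least once
    and forgotten its starting point. *)
Lemma iter_lazyE k x (A : set T) : measurable A ->
  kernel_iter lazy_kernel k x A =
  ((b%:num ^+ k)%:E * \d_x A + (1 - b%:num ^+ k)%:E * pi A)%E.
Proof.
move=> mA; elim: k x => [|k IH] x /=.
  by rewrite expr0 subrr mul0e adde0 mul1e.
rewrite /kcomp_noparam /=.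
under eq_integral do rewrite IH.
have bk0 : 0 <= b%:num ^+ k by rewrite exprn_ge0.
have b1 : b%:num <= 1 by rewrite -bc1 lerDl.
have bk1 : 0 <= 1 - b%:num ^+ k by rewrite subr_ge0 exprn_ile1.
have m1 : measurable_fun setT (fun y => \d_y A : \bar R).
  rewrite (_ : (fun _ => _) = fun y => (\1_A y)%:E).
    by apply/measurable_EFinP; exact: measurable_indic.
  by apply/funext => y; rewrite diracE indicE.
have pA0 : (0 <= pi A)%E by [].
rewrite integral_lazy; first last.
- by apply: emeasurable_funD => //; exact: measurable_funeM.
- by move=> y; rewrite adde_ge0// mule_ge0// lee_fin.
rewrite ge0_integralD//; first last.
- by move=> y _; rewrite mule_ge0// lee_fin.
- exact: measurable_funeM.
- by move=> y _; rewrite mule_ge0// lee_fin.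
rewrite ge0_integralZl_EFin// integral_prob_cst.
rewrite (_ : (\int[pi]_y \d_y A)%E = pi A); last first.
  under eq_integral do rewrite diracE.
  by rewrite integral_indic// setIT.
rewrite -(@fineK _ (pi A)) ?fin_num_measure// diracE.
rewrite -!(EFinM, EFinD); congr EFin.
have -> : c%:num = 1 - b%:num by rewrite -bc1 addrAC subrr add0r.
rewrite exprS; ring.
Qed.

(** The parts of the two laws that have been refreshed are both proportional to pi
    and cancel. *)
Lemma tv_lazy k x y :
  ((2^-1)%:E * tv_norm (measure_diff (kernel_at (kernel_iter lazy_kernel k) x)
                                     (kernel_at (kernel_iter lazy_kernel k) y))
   <= (b%:num ^+ k)%:E)%E.
Proof.
have bk0 : 0 <= b%:num ^+ k by rewrite exprn_ge0.
have /tv_norm_le/= tv : forall A, measurable A ->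
    (`|measure_diff (kernel_at (kernel_iter lazy_kernel k) x)
       (kernel_at (kernel_iter lazy_kernel k) y) A| <= (b%:num ^+ k)%:E)%E.
  move=> A mA.
  rewrite (_ : measure_diff _ _ A =
    kernel_iter lazy_kernel k x A - kernel_iter lazy_kernel k y A)%E//.
  rewrite !iter_lazyE// !diracE -(@fineK _ (pi A)) ?fin_num_measure//.
  rewrite -!(EFinM, EFinD, EFinN) lee_fin.
  rewrite opprD addrACA subrr addr0 -mulrBr normrM ger0_norm// ler_piMr//.
  by case: (x \in A); case: (y \in A); rewrite /= ?subrr ?subr0 ?sub0r ?normrN ?normr0 ?normr1.
apply: (le_trans (lee_wpmul2l _ tv)); first by rewrite lee_fin.
by rewrite -EFinM lee_fin mulrA mulVf// mul1r.
Qed.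

End Lazy.

Section Source.
Variables (R : realType) (n : nat) (pi : probability (borel 'rV[R]_n.+1) R).
Variables (b c : {nonneg R}) (bc1 : b%:num + c%:num = 1) (c0 : 0 < c%:num).

Definition lazy_source : markov_source R :=
  @MarkovSource R (space R n) (@rV_separable R n) (lazy_kernel pi bc1) pi
    (lazy_invariant pi bc1)
    (fun m inv => lazy_invariant_unique c0 inv).

Lemma lazy_mixing tau : (0 < tau)%N -> b%:num ^+ tau <= 4^-1 ->
  mixing tau lazy_source.
Proof.
move=> tau0 btau k z z'; apply: (le_trans (tv_lazy pi bc1 k z z')).
have b1 : b%:num <= 1 by rewrite -bc1 lerDl.
rewrite lee_fin {1}(divn_eq k tau) exprD mulnC exprM.
apply: le_trans (_ : (b%:num ^+ tau) ^+ (k %/ tau) <= _).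
  by rewrite ler_piMr ?exprn_ge0// exprn_ile1.
by rewrite lerXn2r// nnegrE ?exprn_ge0// invr_ge0.
Qed.

End Source.

(** * Expectations along a path of the chain *)

(** Joint measurability of g in the parameter and in the n states of a path. It is
    stated by the recursion that defines path expectations, which peels off one
    state at a time and makes it a parameter; lists need no sigma-algebra. *)
Fixpoint path_measurable (R : realType) (n : nat) (dT : measure_display)
    (T : measurableType dT) (dP : measure_display) (P : measurableType dP)
    (g : P -> seq T -> \bar R) : Prop :=
  match n with
  | 0 => measurable_fun setT (fun p => g p [::])
  | n'.+1 => path_measurable n' (fun (pz : P * T) s => g pz.1 (pz.2 :: s))
  end.

Section PathMeasurable.
Variables (R : realType) (dT : measure_display) (T : measurableType dT).

Lemma path_measurable_comp n dP (P : measurableType dP) dP' (P' : measurableType dP')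
    (phi : P' -> P) (g : P -> seq T -> \bar R) :
  measurable_fun setT phi -> path_measurable n g ->
  path_measurable n (g \o phi).
Proof.
elim: n dP P dP' P' phi g => [|n IH] dP P dP' P' phi g mphi /= mg.
  exact: (measurableT_comp mg mphi).
apply: (IH _ _ _ _ (fun pz : P' * T => (phi pz.1, pz.2)) _ _ mg).
by apply: measurable_fun_pair => //; exact: measurableT_comp.
Qed.

End PathMeasurable.

Section PathExpectation.
Variables (R : realType) (dT : measure_display) (T : measurableType dT).
Variables (pi : probability T R) (b c : {nonneg R}) (bc1 : b%:num + c%:num = 1).
Notation Q := (lazy_kernel pi bc1).
Notation PE := (path_expectation Q).
Local Open Scope ereal_scope.

Lemma path_expectation_ge0 n (m : {measure set T -> \bar R}) g :
  (forall s, 0 <= g s) -> 0 <= PE m n g.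
Proof.
elim: n m g => [|n IH] m g g0 //=.
by apply: integral_ge0 => z _; exact: IH.
Qed.

(** The starting state depends on the parameter because, in the recursion, the state
    just drawn is both the start of what follows and a parameter of g. *)
Lemma measurable_path_expectation n dP (P : measurableType dP) (s : P -> T)
    (g : P -> seq T -> \bar R) :
  measurable_fun setT s -> (forall p zs, 0 <= g p zs) -> path_measurable n g ->
  measurable_fun setT (fun p => PE (Q (s p)) n (g p)).
Proof.
elim: n dP P s g => [|n IH] dP P s g ms g0 mg //=.
have mG : measurable_fun setT
    (fun pz : P * T => PE (Q pz.2) n (fun zs => g pz.1 (pz.2 :: zs))).
  by apply: (IH _ _ snd (fun (pz : P * T) zs => g pz.1 (pz.2 :: zs))).
have G0 p z : 0 <= PE (Q z) n (fun zs => g p (z :: zs)).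
  exact: path_expectation_ge0.
rewrite (_ : (fun _ => _) = (fun p =>
    b%:num%:E * PE (Q (s p)) n (fun zs => g p (s p :: zs)) +
    c%:num%:E * \int[pi]_w PE (Q w) n (fun zs => g p (w :: zs)))).
  apply: emeasurable_funD; apply: measurable_funeM.
    apply: (measurableT_comp mG (_ : measurable_fun setT (fun p => (p, s p)))).
    exact: measurable_fun_pair.
  by apply: (@measurable_fun_fubini_tonelli_F _ _ _ _ _ pi _ mG).
apply/funext => p; rewrite integral_lazy//; first by move=> y; exact: G0.
by apply: (measurableT_comp mG (_ : measurable_fun setT (fun z => (p, z)))); exact: measurable_fun_pair.
Qed.

Lemma measurable_path_step n dP (P : measurableType dP)
    (g : P -> seq T -> \bar R) :
  (forall p zs, 0 <= g p zs) -> path_measurable n.+1 g ->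
  measurable_fun setT
    (fun pz : P * T => PE (Q pz.2) n (fun zs => g pz.1 (pz.2 :: zs))).
Proof.
by move=> g0 mg; exact: (measurable_path_expectation (s := snd) _ _ mg).
Qed.

Lemma measurable_path_stepr n dP (P : measurableType dP)
    (g : P -> seq T -> \bar R) p :
  (forall p zs, 0 <= g p zs) -> path_measurable n.+1 g ->
  measurable_fun setT (fun z => PE (Q z) n (fun zs => g p (z :: zs))).
Proof.
move=> g0 mg; have mG := measurable_path_step g0 mg.
by apply: (measurableT_comp mG (_ : measurable_fun setT (fun z => (p, z)))); exact: measurable_fun_pair.
Qed.

(** The comparison is required on lists of length n only, since bounds on what the
    calls reveal depend on their number. *)
Lemma le_path_expectation n (m : {measure set T -> \bar R}) dP
    (P : measurableType dP) (g1 g2 : P -> seq T -> \bar R) p :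
  (forall p zs, 0 <= g1 p zs) -> (forall p zs, 0 <= g2 p zs) ->
  path_measurable n g1 -> path_measurable n g2 ->
  (forall zs, size zs = n -> g1 p zs <= g2 p zs) ->
  PE m n (g1 p) <= PE m n (g2 p).
Proof.
elim: n m dP P g1 g2 p => [|n IH] m dP P g1 g2 p g10 g20 m1 m2 g12 /=.
  exact: g12.
apply: ge0_le_integral => //.
- by move=> z _; exact: path_expectation_ge0.
- exact: measurable_path_stepr.
- exact: measurable_path_stepr.
- move=> z _.
  by apply: (IH _ _ _ (fun (pz : P * T) zs => g1 pz.1 (pz.2 :: zs))
    (fun (pz : P * T) zs => g2 pz.1 (pz.2 :: zs)) (p, z)) => // zs szs;
  apply: g12; rewrite /= szs.
Qed.

Lemma path_expectationD n (m : {measure set T -> \bar R}) dP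
    (P : measurableType dP) (g1 g2 : P -> seq T -> \bar R) p :
  (forall p zs, 0 <= g1 p zs) -> (forall p zs, 0 <= g2 p zs) ->
  path_measurable n g1 -> path_measurable n g2 ->
  PE m n (fun zs => g1 p zs + g2 p zs) = PE m n (g1 p) + PE m n (g2 p).
Proof.
elim: n m dP P g1 g2 p => [|n IH] m dP P g1 g2 p g10 g20 m1 m2 //=.
rewrite -ge0_integralD//; first last.
- exact: measurable_path_stepr.
- by move=> z _; exact: path_expectation_ge0.
- exact: measurable_path_stepr.
- by move=> z _; exact: path_expectation_ge0.
apply: eq_integral => z _.
by apply: (IH _ _ _ (fun (pz : P * T) zs => g1 pz.1 (pz.2 :: zs))
    (fun (pz : P * T) zs => g2 pz.1 (pz.2 :: zs)) (p, z)).
Qed.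

(** Tonelli, one state at a time. *)
Lemma path_expectation_lazy_swap n z dU (U : measurableType dU)
    (mu : probability U R) dP (P : measurableType dP)
    (g : P * U -> seq T -> \bar R) p :
  (forall p zs, 0 <= g p zs) -> path_measurable n g ->
  PE (Q z) n (fun zs => \int[mu]_u g (p, u) zs) =
  \int[mu]_u PE (Q z) n (g (p, u)).
Proof.
elim: n z dP P g p => [|n IH] z dP P g p g0 mg //=.
pose G := fun pz : (P * U) * T => PE (Q pz.2) n (fun zs => g pz.1 (pz.2 :: zs)).
have mG : measurable_fun setT G by exact: measurable_path_step.
have G0 pz : 0 <= G pz by exact: path_expectation_ge0.
have mGp : measurable_fun setT (fun zu : T * U => G ((p, zu.2), zu.1)).
  apply: (measurableT_comp mG).
  apply: measurable_fun_pair => //.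
  by apply: measurable_fun_pair.
have mGu u : measurable_fun setT (fun z => G ((p, u), z)).
  by apply: (measurableT_comp mG); exact: measurable_fun_pair.
have mGz z' : measurable_fun setT (fun u => G ((p, u), z')).
  apply: (measurableT_comp mG); apply: measurable_fun_pair => //.
transitivity (\int[Q z]_z' \int[mu]_u G ((p, u), z')).
  apply: eq_integral => z' _.
  apply: (IH z' _ _ (fun (q : (P * T) * U) zs => g (q.1.1, q.2) (q.1.2 :: zs))
    (p, z')) => //.
  apply: (@path_measurable_comp _ _ _ n _ _ _ _
     (fun q : (P * T) * U => ((q.1.1, q.2), q.1.2)) _ _ mg).
  apply: measurable_fun_pair; last exact: measurableT_comp.
  by apply: measurable_fun_pair => //; exact: measurableT_comp.
rewrite integral_lazy; first last.
- by apply: (@measurable_fun_fubini_tonelli_F _ _ _ _ _ mu _ mGp).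
- by move=> z'; apply: integral_ge0.
transitivity (\int[mu]_u \int[Q z]_z' G ((p, u), z')); last by [].
under [RHS]eq_integral => u _ do
  rewrite (integral_lazy pi bc1 z (fun z' => G0 (p, u, z')) (mGu u)).
rewrite [RHS]ge0_integralD//; first last.
- by apply: measurable_funeM; exact: (@measurable_fun_fubini_tonelli_G _ _ _ _ _ pi _ mGp).
- by move=> u _; rewrite mule_ge0//; apply: integral_ge0.
- exact: measurable_funeM.
- by move=> u _; rewrite mule_ge0//; exact: G0.
rewrite !ge0_integralZl_EFin//.
- by rewrite (@fubini_tonelli _ _ _ _ _ pi mu _ mGp).
- by move=> u _; apply: integral_ge0.
- by exact: (@measurable_fun_fubini_tonelli_G _ _ _ _ _ pi _ mGp).
Qed.

Lemma path_expectationZ n (m : {measure set T -> \bar R}) dP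
    (P : measurableType dP) (g : P -> seq T -> \bar R) p (k : R) : (0 <= k)%R ->
  (forall p zs, 0 <= g p zs) -> path_measurable n g ->
  PE m n (fun zs => k%:E * g p zs) = k%:E * PE m n (g p).
Proof.
move=> k0; elim: n m dP P g p => [|n IH] m dP P g p g0 mg //=.
rewrite -ge0_integralZl_EFin//; first last.
- exact: measurable_path_stepr.
- by move=> z _; exact: path_expectation_ge0.
apply: eq_integral => z _.
by apply: (IH _ _ _ (fun (pz : P * T) zs => g pz.1 (pz.2 :: zs)) (p, z)).
Qed.

Lemma path_expectation_cst n (k : R) : PE pi n (fun=> k%:E) = k%:E.
Proof.
have H z m : PE (Q z) m (fun=> k%:E) = k%:E.
  elim: m z => [|m IH] z //=.
  under eq_integral do rewrite IH.
  rewrite integral_cst// -[X in _ * X]/(Q z setT) prob_kernel mule1//.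
case: n => [|n] //=; under eq_integral do rewrite H.
exact: integral_prob_cst.
Qed.

Lemma measurable_path_expectation_init n dP (P : measurableType dP)
    (g : P -> seq T -> \bar R) :
  (forall p zs, 0 <= g p zs) -> path_measurable n g ->
  measurable_fun setT (fun p => PE pi n (g p)).
Proof.
case: n => [|n] g0 mg //=.
have mG := measurable_path_step g0 mg.
apply: (@measurable_fun_fubini_tonelli_F _ _ _ _ _ pi _ mG) => pz.
exact: path_expectation_ge0.
Qed.

Lemma path_expectation_swap n dU (U : measurableType dU) (mu : probability U R)
    (g : U -> seq T -> \bar R) :
  (forall p zs, 0 <= g p zs) -> path_measurable n g ->
  PE pi n (fun zs => \int[mu]_u g u zs) = \int[mu]_u PE pi n (g u).
Proof.
case: n => [|n] g0 mg //=.
have mG := measurable_path_step g0 mg.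
have G0 u z : 0 <= PE (Q z) n (fun zs => g u (z :: zs)).
  exact: path_expectation_ge0.
have mG' : measurable_fun setT (fun zu : T * U =>
    PE (Q zu.1) n (fun zs => g zu.2 (zu.1 :: zs))).
  apply: (measurableT_comp mG (_ : measurable_fun setT (fun zu : T * U => (zu.2, zu.1)))).
  exact: measurable_fun_pair.
rewrite -(@fubini_tonelli _ _ _ _ _ pi mu _ mG')//.
apply: eq_integral => z _.
apply: (@path_expectation_lazy_swap n z _ U mu _ T
  (fun (q : T * U) zs => g q.2 (q.1 :: zs)) z) => //.
apply: (@path_measurable_comp _ _ _ n _ _ _ _ (fun q : T * U => (q.2, q.1)) _ _ mg).
exact: measurable_fun_pair.
Qed.

End PathExpectation.

(** * One step of the comparison *)

Section ShiftStep.
Variables (R : realType) (dT : measure_display) (T : measurableType dT).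
Variables (pi : probability T R).
Variables (sh : T -> T) (L : T -> R) (M : R).
Hypothesis msh : measurable_fun setT sh.
Hypothesis mL : measurable_fun setT L.
Hypothesis L0 : forall w, 0 < L w.
Hypothesis changeL : forall f : T -> \bar R, (forall w, (0 <= f w)%E) ->
  measurable_fun setT f ->
  (\int[pi]_w f (sh w) = \int[pi]_w (f w * (L w)%:E))%E.
Hypothesis L2 : (\int[pi]_w ((L w) ^+ 2)%:E <= M%:E)%E.

(** One call at a fresh state. D is the quantity of interest under one sign vector
    as a function of the current noise w, V its analogue under the flipped
    vector, and the hypothesis says that D at w is controlled by V at the
    translated noise, with a free parameter lam' that may depend on w. Taking
    lam' proportional to the likelihood ratio L at the translated point makes the
    weight of V, after the change of variables, free of L; the ratio reappears
    squared in the additive term, where its second moment M is paid for by r^2. *)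
Lemma shift_step_fresh (rho r lam : R) (D V : T -> \bar R) :
  0 <= rho -> 0 < r -> 0 < lam ->
  (forall w, (0 <= D w)%E) -> (forall w, (0 <= V w)%E) ->
  measurable_fun setT D -> measurable_fun setT V ->
  (forall lam' w, 0 < lam' -> (D w <= (rho * r * lam' / 2)%:E +
      (rho * r / (2 * lam'))%:E * V (sh w))%E) ->
  (\int[pi]_w D w <= (rho * lam / 2 * (r ^+ 2 * M))%:E +
     (rho / (2 * lam))%:E * \int[pi]_w V w)%E.
Proof.
move=> rho0 r0 lam0 D0 V0 mD mV DV.
pose H y := ((rho * r ^+ 2 * lam / 2 * L y)%:E +
  (rho / (2 * lam) * (L y)^-1)%:E * V y)%E.
have mLV : measurable_fun setT (fun y => (L y)^-1).
  exact: (measurableT_comp (@measurable_inv R) mL).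
have mH : measurable_fun setT H.
  apply: emeasurable_funD.
    by apply/measurable_EFinP; exact: measurable_funM.
  apply: emeasurable_funM => //.
  by apply/measurable_EFinP; exact: measurable_funM.
have H0 y : (0 <= H y)%E.
  rewrite adde_ge0// ?mule_ge0// lee_fin ?mulr_ge0// ?invr_ge0 ?mulr_ge0//;
  by rewrite ltW// ?L0// exprn_gt0.
have DH w : (D w <= H (sh w))%E.
  (* This choice of lam' cancels L in the second term after the change of variables. *)
  apply: le_trans (DV (r * lam * L (sh w)) w _) _; first by rewrite !mulr_gt0.
  rewrite /H leeD//; first by rewrite lee_fin le_eqVlt; apply/orP; left; apply/eqP; ring.
  rewrite lee_wpmul2r// lee_fin le_eqVlt; apply/orP; left; apply/eqP.
  by field; rewrite !gt_eqF.
apply: (@le_trans _ _ (\int[pi]_w H (sh w))%E).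
  by apply: ge0_le_integral => //; exact: measurableT_comp.
rewrite changeL//.
have E w : (H w * (L w)%:E = (rho * r ^+ 2 * lam / 2)%:E * ((L w) ^+ 2)%:E +
    (rho / (2 * lam))%:E * V w)%E.
  rewrite /H ge0_muleDl//; first last.
  - by rewrite mule_ge0// lee_fin !mulr_ge0// ?invr_ge0 ?mulr_ge0// ltW.
  - by rewrite lee_fin !mulr_ge0// ?exprn_ge0// ltW.
  congr (_ + _)%E; first by rewrite -!EFinM; congr EFin; ring.
  rewrite muleAC -EFinM; congr (_%:E * _)%E.
  by field; rewrite !gt_eqF.
under eq_integral do rewrite E.
have mL2 : measurable_fun setT (fun w => ((L w) ^+ 2)%:E).
  by apply/measurable_EFinP; exact: measurable_funX.
have c1 : 0 <= rho * r ^+ 2 * lam / 2 by rewrite !mulr_ge0// ?exprn_ge0// ltW.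
have c2 : 0 <= rho / (2 * lam) by rewrite mulr_ge0// invr_ge0 mulr_ge0// ltW.
rewrite ge0_integralD//; first last.
- exact: measurable_funeM.
- by move=> w _; rewrite mule_ge0.
- exact: measurable_funeM.
- by move=> w _; rewrite mule_ge0// lee_fin// exprn_ge0// ltW.
rewrite !ge0_integralZl_EFin//; last by move=> w _; rewrite lee_fin exprn_ge0// ltW.
rewrite leeD2r//; apply: le_trans (lee_wpmul2l _ L2) _; first by rewrite lee_fin.
rewrite -EFinM lee_fin le_eqVlt; apply/orP; left; apply/eqP; ring.
Qed.

(** One step of the chain: with probability b the state is kept and lam' = r lam
    suffices, with probability c it is fresh and costs the second moment M. When
    b is positive the kept states z and z' must already differ by the current
    translation. *)
Lemma shift_step_lazy (b c : R) z z' (rho r lam : R) (D V : T -> \bar R) :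
  0 <= b -> 0 <= c -> b + c = 1 -> b = 0 \/ z' = sh z ->
  r ^+ 2 * (b + c * M) <= 1 ->
  0 <= rho -> 0 < r -> 0 < lam ->
  (forall w, (0 <= D w)%E) -> (forall w, (0 <= V w)%E) ->
  measurable_fun setT D -> measurable_fun setT V ->
  (forall lam' w, 0 < lam' -> (D w <= (rho * r * lam' / 2)%:E +
      (rho * r / (2 * lam'))%:E * V (sh w))%E) ->
  (b%:E * D z + c%:E * \int[pi]_w D w <= (rho * lam / 2)%:E +
     (rho / (2 * lam))%:E * (b%:E * V z' + c%:E * \int[pi]_w V w))%E.
Proof.
move=> b0 c0 bc1 zz' r2 rho0 r0 lam0 D0 V0 mD mV DV.
have F := shift_step_fresh rho0 r0 lam0 D0 V0 mD mV DV.
have c2 : 0 <= rho / (2 * lam) by rewrite mulr_ge0// invr_ge0 mulr_ge0// ltW.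
have G : (b%:E * D z <= (b * (rho * lam / 2) * r ^+ 2)%:E +
    (rho / (2 * lam))%:E * (b%:E * V z'))%E.
  case: zz' => [->|->].
    by rewrite !mul0e mule0 adde0 !mul0r.
  apply: (le_trans (lee_wpmul2l _ (DV (r * lam) z _))).
  - by rewrite lee_fin.
  - exact: mulr_gt0.
  rewrite ge0_muleDr//; first last.
  - by rewrite mule_ge0// lee_fin mulr_ge0// ?invr_ge0 ?mulr_ge0// ltW.
  - by rewrite lee_fin !mulr_ge0// ltW.
  rewrite !muleA -!EFinM.
  rewrite leeD//.
    by rewrite lee_fin le_eqVlt; apply/orP; left; apply/eqP; ring.
  rewrite lee_wpmul2r// lee_fin le_eqVlt; apply/orP; left; apply/eqP.
  by field; rewrite !gt_eqF.
have H : (c%:E * \int[pi]_w D w <= (c * (rho * lam / 2) * (r ^+ 2 * M))%:E +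
    (rho / (2 * lam))%:E * (c%:E * \int[pi]_w V w))%E.
  apply: (le_trans (lee_wpmul2l _ F)); first by rewrite lee_fin.
  rewrite [in leRHS]muleCA; case: (ltP 0 c) => [cp|c0'].
    rewrite muleDr ?fin_num_adde_defr// -EFinM leeD2r// lee_fin.
    by rewrite le_eqVlt; apply/orP; left; apply/eqP; ring.
  have -> : c = 0 by apply/eqP; rewrite eq_le c0' c0.
  by rewrite !mul0e !mul0r add0e.
apply: (le_trans (leeD G H)).
rewrite addeACA -EFinD [in leRHS]ge0_muleDr//; first last.
- by rewrite mule_ge0// integral_ge0.
- by rewrite mule_ge0.
rewrite leeD2r// lee_fin.
rewrite (_ : _ + _ = rho * lam / 2 * (r ^+ 2 * (b + c * M))); last by ring.
by rewrite ler_piMr// !mulr_ge0// ltW.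
Qed.
End ShiftStep.

(** * Histories and discounts along a run *)

Section Runs.
Variables (R : realType) (n : nat) (dX dO : measure_display).
Variables (X : measurableType dX) (O : measurableType dO).
Variables (A : algorithm R n X O).
Variables (dT : measure_display) (T : measurableType dT).

(** Histories of every fixed length are measurable tuples; a function of histories
    is measurable when all its restrictions to tuples are. *)
Definition history_measurable (dV : measure_display) (V : measurableType dV)
    (Phi : rand A -> seq O -> V) :=
  forall k, measurable_fun setT (fun p : rand A * k.-tuple O => Phi p.1 p.2).

Lemma measurable_rcons dP (P : measurableType dP) k (h : P -> k.-tuple O)
    (o : P -> O) : measurable_fun setT h -> measurable_fun setT o ->
  measurable_fun setT (fun p => [tuple of rcons (h p) (o p)]).
Proof.
move=> mh mo; apply/measurable_fun_tnthP => i /=.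
have [ik|ki] := ltnP i k.
  rewrite (_ : _ \o _ = fun p => tnth (h p) (Ordinal ik)).
    by apply: (@measurableT_comp _ _ _ _ _ _ (fun x => tnth x _)) => //; exact: measurable_tnth.
  by apply/funext => p /=; rewrite !(tnth_nth (o p))/= nth_rcons size_tuple ik.
rewrite (_ : _ \o _ = o)//; apply/funext => p /=.
rewrite (tnth_nth (o p))/= nth_rcons size_tuple ltnNge ki/=.
by rewrite (_ : nat_of_ord i == k)// eqn_leq ki andbT -ltnS.
Qed.

Lemma path_measurable_observations (oracle : X -> T -> O) m dP
    (P : measurableType dP) k (u : P -> rand A) (h : P -> k.-tuple O)
    (Phi : rand A -> seq O -> \bar R) :
  measurable_fun setT (fun p : X * T => oracle p.1 p.2) ->
  history_measurable Phi ->
  measurable_fun setT u -> measurable_fun setT h ->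
  path_measurable m (fun p (zs : seq T) => Phi (u p) (observations oracle (u p) (h p) zs)).
Proof.
move=> mo mPhi; elim: m dP P k u h => [|m IH] dP P k u h mu mh /=.
  apply: (measurableT_comp (mPhi k) (_ : measurable_fun setT (fun p => (u p, h p)))).
  exact: measurable_fun_pair.
apply: (IH _ _ _ (fun pz : P * T => u pz.1)
  (fun pz : P * T => [tuple of rcons (h pz.1) (oracle (query (u pz.1) (h pz.1)) pz.2)])).
  exact: measurableT_comp.
apply: measurable_rcons; first exact: measurableT_comp.
apply: (measurableT_comp mo (_ : measurable_fun setT (fun pz : P * T =>
  (query (u pz.1) (h pz.1), pz.2)))).
apply: measurable_fun_pair => //.
have mq : measurable_fun setT (fun pz : P * T => (u pz.1, h pz.1)).
  by apply: measurable_fun_pair; exact: measurableT_comp.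
exact: (measurableT_comp (@query_measurable _ _ _ _ _ _ A k) mq).
Qed.

Variables (r : nat -> X -> R).

(** The k-th query is a function of the first k observations, so the product of the
    factors paid at the calls of a run is determined by its history. *)
Definition discount (u : rand A) (h : seq O) : R :=
  \prod_(k < size h) r k (query u (take k h)).

Lemma discount_rcons u h o :
  discount u (rcons h o) = discount u h * r (size h) (query u h).
Proof.
rewrite /discount size_rcons big_ord_recr/=; congr (_ * r _ (query u _)).
  apply: eq_bigr => k _; congr (r _ (query u _)).
  by rewrite -cats1 takel_cat// ltnW.
by rewrite -cats1 take_size_cat.
Qed.

Lemma history_measurable_discount :
  (forall k, measurable_fun setT (r k)) -> history_measurable discount.
Proof.
move=> mr m; rewrite /discount.
under eq_fun do rewrite size_tuple.
apply: measurable_prod => k _.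
apply: (measurableT_comp (mr k)).
have km : (k <= m)%N by rewrite ltnW.
have mt : measurable_fun setT (fun h : m.-tuple O => [tuple tnth h (widen_ord km i) | i < k]).
  apply/measurable_fun_tnthP => i /=.
  rewrite (_ : _ \o _ = fun h => tnth h (widen_ord km i)).
    exact: measurable_tnth.
  by apply/funext => h /=; rewrite tnth_mktuple.
rewrite (_ : (fun _ => _) = (fun p : rand A * k.-tuple O => query p.1 p.2) \o
   (fun p : rand A * m.-tuple O => (p.1, [tuple tnth p.2 (widen_ord km i) | i < k]))).
  apply: measurableT_comp; first exact: query_measurable.
  by apply: measurable_fun_pair => //; exact: (measurableT_comp mt).
apply/funext => -[u h] /=; congr query.
apply: (@eq_from_nth _ (point : O)).
  by rewrite size_map size_enum_ord size_takel// size_tuple.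
rewrite size_takel ?size_tuple// => i ik.
rewrite nth_take// (nth_map (Ordinal ik)) ?size_enum_ord//.
by rewrite (tnth_nth point)/= nth_enum_ord.
Qed.

End Runs.

(** * Comparison of two runs *)

Section Compare.
Variables (R : realType) (n : nat) (dX dO : measure_display).
Variables (X : measurableType dX) (O : measurableType dO).
Variables (A : algorithm R n X O).
Variables (dT : measure_display) (T : measurableType dT).
Variables (pi : probability T R) (b c : {nonneg R}) (bc1 : b%:num + c%:num = 1).
Notation Q := (lazy_kernel pi bc1).
Notation PE := (path_expectation Q).
Variables (orc1 orc2 : X -> T -> O) (sh : X -> T -> T) (L : X -> T -> R).
Variables (M : X -> R) (r : nat -> X -> R).
Hypothesis morc1 : measurable_fun setT (fun p : X * T => orc1 p.1 p.2).
Hypothesis morc2 : measurable_fun setT (fun p : X * T => orc2 p.1 p.2).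
Hypothesis orcE : forall x z, orc1 x z = orc2 x (sh x z).
Hypothesis msh : forall x, measurable_fun setT (sh x).
Hypothesis mL : forall x, measurable_fun setT (L x).
Hypothesis L0 : forall x w, 0 < L x w.
Hypothesis changeL : forall x (f : T -> \bar R), (forall w, (0 <= f w)%E) ->
  measurable_fun setT f ->
  (\int[pi]_w f (sh x w) = \int[pi]_w (f w * (L x w)%:E))%E.
Hypothesis L2 : forall x, (\int[pi]_w ((L x w) ^+ 2)%:E <= (M x)%:E)%E.
Hypothesis mr : forall k, measurable_fun setT (r k).
Hypothesis r_gt0 : forall k x, 0 < r k x.
Hypothesis r0M : forall x, r 0 x ^+ 2 * M x <= 1.
Hypothesis rSM : forall k x, r k.+1 x ^+ 2 * (b%:num + c%:num * M x) <= 1.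
Variables (psi : rand A -> seq O -> R).
Hypothesis mpsi : history_measurable psi.
Hypothesis psi01 : forall u h, 0 <= psi u h <= 1.

Notation disc := (discount r).
Notation obs1 := (observations orc1).
Notation obs2 := (observations orc2).

Lemma discount_ge0 (u : rand A) h : 0 <= disc u h.
Proof. by apply: prodr_ge0 => k _; rewrite ltW. Qed.

Let psi_young (u : rand A) h lam : 0 < lam -> psi u h <= lam / 2 + psi u h / (2 * lam).
Proof.
move=> lam0; have /andP[p0 p1] := psi01 u h; set p := psi u h in p0 p1 *.
rewrite -subr_ge0 (_ : _ - _ = ((lam - p) ^+ 2 + p * (1 - p)) / (2 * lam)).
  by rewrite divr_ge0 ?addr_ge0 ?sqr_ge0 ?mulr_ge0// ?subr_ge0// ltW.
by field; rewrite gt_eqF.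
Qed.

Let Phi u h := (disc u h * psi u h)%:E.
Let Psi u h := (psi u h)%:E.

Let mPhi : history_measurable Phi.
Proof.
move=> k; apply/measurable_EFinP; apply: measurable_funM; last exact: mpsi.
exact: history_measurable_discount.
Qed.

Let mPsi : history_measurable Psi.
Proof. by move=> k; apply/measurable_EFinP; exact: mpsi. Qed.

Let Phi0 u h : (0 <= Phi u h)%E.
Proof. by rewrite lee_fin mulr_ge0 ?discount_ge0//; have /andP[] := psi01 u h. Qed.

Let Psi0 u h : (0 <= Psi u h)%E.
Proof. by rewrite lee_fin; have /andP[] := psi01 u h. Qed.

Let step_measurable (orc : X -> T -> O) (F : rand A -> seq O -> \bar R) u m k
    (h : k.-tuple O) :
  measurable_fun setT (fun p : X * T => orc p.1 p.2) ->
  history_measurable F -> (forall u h, (0 <= F u h)%E) ->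
  measurable_fun setT (fun w => PE (Q w) m (fun zs =>
    F u (observations orc u (rcons h (orc (query u h) w)) zs))).
Proof.
move=> mo mF F0.
apply: (@measurable_path_expectation _ _ _ pi b c bc1 m _ T id
  (fun w zs => F u (observations orc u (rcons h (orc (query u h) w)) zs))) => //.
apply: (@path_measurable_observations _ _ _ _ _ _ _ _ _ _ _ _ _ _ (fun=> u)
  (fun w => [tuple of rcons h (orc (query u h) w)])) => //.
apply: measurable_rcons => //.
apply: (measurableT_comp mo (_ : measurable_fun setT (fun w => (query u h, w)))).
exact: measurable_fun_pair.
Qed.

(** Induction on the number of remaining calls, [shift_step_lazy] being the step.
    The discount already paid is factored through, and lam is universally
    quantified in the induction because the step chooses it depending on the
    noise. The history has at least one observation, since the state z has been
    seen. *)
Lemma compare_runs_from u m k (h : k.+1.-tuple O) z z' lam : 0 < lam ->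
  b%:num = 0 \/ (exists2 sh0, forall x, sh x = sh0 & z' = sh0 z) ->
  (PE (Q z) m (fun zs => Phi u (obs1 u h zs)) <=
   (disc u h * lam / 2)%:E + (disc u h / (2 * lam))%:E *
     PE (Q z') m (fun zs => Psi u (obs2 u h zs)))%E.
Proof.
elim: m k h z z' lam => [|m IH] k h z z' lam lam0 zz'.
  rewrite /= /Phi /Psi -EFinM -EFinD lee_fin -!mulrA -mulrDr.
  by rewrite ler_wpM2l ?discount_ge0// [_^-1 * _]mulrC psi_young.
rewrite /= !integral_lazy//; first last.
- exact: step_measurable.
- by move=> w; apply: path_expectation_ge0 => zs; first [exact: Psi0|exact: Phi0].
- exact: step_measurable.
- by move=> w; apply: path_expectation_ge0 => zs; first [exact: Psi0|exact: Phi0].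
apply: (@shift_step_lazy _ _ _ pi (sh (query u h)) (L (query u h)) (M (query u h))
  _ _ _ _ _ b%:num c%:num z z' (disc u h) (r k.+1 (query u h)) lam) => //.
- exact: changeL.
- by case: zz' => [->|[sh0 shE ->]]; [left|right; rewrite shE].
- exact: discount_ge0.
- by move=> w; apply: path_expectation_ge0 => zs; exact: Phi0.
- by move=> w; apply: path_expectation_ge0 => zs; exact: Psi0.
- exact: step_measurable.
- exact: step_measurable.
- move=> lam' w lam'0; rewrite orcE.
  have := IH _ [tuple of rcons h (orc2 (query u h) (sh (query u h) w))] w
    (sh (query u h) w) lam' lam'0.
  rewrite /= discount_rcons size_tuple; apply.
  by case: zz' => [->|[sh0 shE _]]; [left|right; exists sh0; rewrite ?shE].
Qed.

(** The first state is drawn from pi, so the first call always meets a fresh state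
    and pays the full price M, which is why r 0 obeys a stronger condition than
    the later factors. *)
Lemma compare_runs u m lam : 0 < lam ->
  b%:num = 0 \/ (exists sh0, forall x, sh x = sh0) ->
  (PE pi m (fun zs => Phi u (obs1 u [::] zs)) <=
   (lam / 2)%:E + ((2 * lam)^-1)%:E * PE pi m (fun zs => Psi u (obs2 u [::] zs)))%E.
Proof.
move=> lam0 shc; case: m => [|m].
  rewrite /= /Phi /Psi -EFinM -EFinD lee_fin /discount big_ord0 mul1r.
  by rewrite [_^-1 * _]mulrC psi_young.
have := @shift_step_fresh _ _ _ pi (sh (query u [::])) (L (query u [::])) (M (query u [::]))
  (msh _) (mL _) (L0 _) (@changeL (query u [::])) (L2 _) 1 (r 0 (query u [::])) lam.
have mstep orc F := @step_measurable orc F u m 0 [tuple].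
move=> /(_ _ _ ler01 (r_gt0 _ _) lam0 _ _ (mstep _ _ morc1 mPhi Phi0) (mstep _ _ morc2 mPsi Psi0)).
rewrite /=; set I1 := integral _ _ _; set I2 := integral _ _ _ => H.
apply: le_trans (H _ _ _) _.
- by move=> w; apply: path_expectation_ge0 => zs; exact: Phi0.
- by move=> w; apply: path_expectation_ge0 => zs; exact: Psi0.
- move=> lam' w lam'0; rewrite orcE.
  have := @compare_runs_from u m 0 [tuple orc2 (query u [::]) (sh (query u [::]) w)] w
    (sh (query u [::]) w) lam' lam'0.
  rewrite /= (_ : disc u [:: _] = r 0 (query u [::])) ?mul1r; last first.
    by rewrite /discount big_ord_recl big_ord0 mulr1.
  apply.
  by case: shc => [|[sh0 shE]]; [left|right; exists sh0; rewrite ?shE].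
- by rewrite !mul1r leeD2r// lee_fin ler_piMr// divr_ge0// ltW.
Qed.

End Compare.

(** * Translation of the Gaussian law on the line *)

Section Gauss1.
Variable R : realType.
Local Notation mu := (@lebesgue_measure R).
Local Open Scope ereal_scope.

(** The image of the Lebesgue measure under a translation agrees with it on
    intervals. *)
Lemma integral_lebesgue_shift (t : R) (f : R -> \bar R) :
  measurable_fun setT f -> (forall x, 0 <= f x) ->
  \int[mu]_x f (x + t)%R = \int[mu]_x f x.
Proof.
move=> mf f0.
have mt : measurable_fun setT (fun x : measurableTypeR R => (x + t)%R : measurableTypeR R).
  exact: measurable_funD.
transitivity (\int[pushforward mu (fun x : measurableTypeR R => (x + t)%R : measurableTypeR R)]_x f x).
  by rewrite ge0_integral_pushforward// preimage_setT.
apply: eq_measure_integral => A mA _.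
apply/esym; apply: (@lebesgue_measure_unique R) => // X [[x y] _ <-] /=.
rewrite /pushforward.
rewrite (_ : _ @^-1` _ = `](x - t)%R, (y - t)%R]%classic); last first.
  by apply/seteqP; split=> z /=; rewrite !in_itv/= ltrBlDr lerBrDr.
rewrite !lebesgue_measure_itv/= !lte_fin ltrD2r; case: ifP => // _.
by rewrite -!EFinB; congr EFin; ring.
Qed.

(** The normal law is the integral of its density over sets, so the density agrees
    almost everywhere with the Radon-Nikodym derivative. *)
Lemma integral_gauss (f : R -> \bar R) :
  measurable_fun setT f -> (forall x, 0 <= f x) ->
  \int[normal_prob 0 1]_x f x = \int[mu]_x (f x * (normal_pdf 0 1 x)%:E).
Proof.
move=> mf f0.
have dom := @normal_prob_dominates R 0 1.
rewrite -(Radon_Nikodym_SigmaFinite.change_of_variables dom)//.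
have mpdf : measurable_fun setT (fun x => (normal_pdf 0 1 x : R)%:E).
  by apply/measurable_EFinP; exact: measurable_normal_pdf.
apply: ae_eq_integral => //.
- apply: emeasurable_funM => //; apply: (measurable_int mu).
  exact: Radon_Nikodym_SigmaFinite.f_integrable.
- exact: emeasurable_funM.
- apply: ae_eqe_mul2l => /=.
  apply: integral_ae_eq => //=.
  + exact: Radon_Nikodym_SigmaFinite.f_integrable.
  + move=> E _ mE; by rewrite -Radon_Nikodym_SigmaFinite.f_integral.
Qed.

Lemma normal_pdf01 (x : R) : normal_pdf 0 1 x = (normal_peak 1 * expR (- (x ^+ 2 / 2)))%R.
Proof.
rewrite /normal_pdf oner_eq0 /normal_fun; congr (_ * expR _)%R.
by rewrite subr0 expr1n mulNr.
Qed.

(** The density at x - t is the density at x times exp (t x - t^2 / 2). *)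
Lemma gauss_shift (t : R) (f : R -> \bar R) :
  measurable_fun setT f -> (forall x, 0 <= f x) ->
  \int[normal_prob 0 1]_x f (x + t)%R =
  \int[normal_prob 0 1]_x (f x * (expR (t * x - t ^+ 2 / 2))%:E).
Proof.
move=> mf f0.
have mE : measurable_fun setT (fun x : R => (expR (t * x - t ^+ 2 / 2))%:E).
  apply/measurable_EFinP; apply: measurableT_comp => //.
  by apply: measurable_funB => //; exact: measurable_funM.
rewrite integral_gauss//; last by apply: (measurableT_comp mf); exact: measurable_funD.
rewrite integral_gauss//; first last.
- by move=> x; rewrite mule_ge0// lee_fin expR_ge0.
- exact: emeasurable_funM.
rewrite -(integral_lebesgue_shift (- t)); first last.
- by move=> x; rewrite mule_ge0// lee_fin normal_pdf_ge0.
- apply: emeasurable_funM; first by apply: (measurableT_comp mf); exact: measurable_funD.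
  by apply/measurable_EFinP; exact: measurable_normal_pdf.
apply: eq_integral => x _.
rewrite subrK -muleA -EFinM; congr (_ * _%:E).
rewrite !normal_pdf01 mulrCA; congr (_ * _)%R.
by rewrite -expRD; congr expR; field.
Qed.
End Gauss1.

(** * The standard Gaussian law on row vectors *)

Section BorelRow.
Variables (R : realType).

(** An open set of rows is a countable union of boxes with rational centres and
    radii 1 / (k + 1), so the Borel sets of rows are generated by the coordinates. *)
Lemma measurable_fun_row d (T : measurableType d) n (h : T -> borel 'rV[R]_n) :
  (forall i, measurable_fun setT (fun x => (h x : 'rV[R]_n) 0 i)) -> measurable_fun setT h.
Proof.
move=> mh; apply: (@measurability _ _ _ (borel 'rV[R]_n) setT h (@open 'rV[R]_n) (erefl _)) => _ /= -[B oB <-]; rewrite setTI.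
pose box (p : {ffun 'I_n -> rat} * nat) : set 'rV[R]_n :=
  [set v | forall i, `|v 0 i - ratr (p.1 i)| < p.2.+1%:R^-1].
have mbox p : measurable (h @^-1` box p).
  rewrite (_ : _ @^-1` _ = \bigcap_(i in [set: 'I_n]) [set x | `|(h x : 'rV[R]_n) 0 i - ratr (p.1 i)| < p.2.+1%:R^-1]).
    apply: fin_bigcap_measurable => [|i _]; first exact: finite_finset.
    rewrite -[X in measurable X]setTI -[X in _ `&` X]/((fun x => `|(h x : 'rV[R]_n) 0 i - ratr (p.1 i)| < p.2.+1%:R^-1) @^-1` [set true]).
    apply: (measurable_fun_ltr (g := cst _)) => //.
    by apply: measurableT_comp => //; apply: measurable_funB => //; exact: mh.
  by apply/seteqP; split => x /= H i; [move=> _|]; apply: H.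
rewrite (_ : h @^-1` B = \bigcup_(p in [set p | box p `<=` B]) (h @^-1` box p)).
  rewrite bigcup_mkcond; apply: countable_bigcupT_measurable => [|p].
    exact: countableP.
  by case: ifP.
apply/seteqP; split => [x Bx|x [p pB]]; last exact: pB.
have /nbhs_ballP[e /= e0 xB] : nbhs (h x : (matrix R 1 n)) B by exact: open_nbhs_nbhs.
have [k /= ke] : exists k, k.+1%:R^-1 < e / 2 :> R.
  exists (Num.truncn (e / 2)^-1); rewrite invf_plt ?posrE ?divr_gt0//.
  exact: truncnS_gt.
have /choice[q qP] : forall i, exists q : rat, `|(h x : 'rV[R]_n) 0 i - ratr q| < k.+1%:R^-1.
  move=> i; set y := (h x : 'rV[R]_n) 0 i.
  have /rat_in_itvoo[q] : y - k.+1%:R^-1 < y + k.+1%:R^-1.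
    by rewrite ltrBlDr -addrA ltrDl addr_gt0// invr_gt0.
  rewrite in_itv/= => /andP[q1 q2]; exists q; rewrite ltr_norml.
  by move: (ratr q) (k.+1%:R^-1) q1 q2 => a b q1 q2; apply/andP; clear -q1 q2; split; lra.
exists (finfun q, k) => /=; last by move=> i; rewrite ffunE; exact: qP.
move=> v vbox; apply: xB; split => // i j; rewrite (ord1 i).
have := vbox j; have := qP j; rewrite /= ffunE /ball/= => h1 h2.
rewrite -(subrKA (ratr (q j))) (le_lt_trans (ler_normD _ _))//.
rewrite (splitr e) ltrD// ?(lt_trans h1)// distrC; exact: lt_trans ke.
Qed.

Lemma measurable_coord n i : measurable_fun setT (fun v : borel 'rV[R]_n => (v : 'rV[R]_n) 0 i).
Proof.
apply: (@measurability _ _ _ _ _ _ _ (RGenOpens.measurableE R)) => _ /= -[_ [x [y ->]] <-].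
rewrite setTI; apply: sub_sigma_algebra.
have : continuous (fun v : 'rV[R]_n => v 0 i) by exact: coord_continuous.
by move/continuousP; apply; exact: interval_open.
Qed.

Definition row_cons n (x : R) (v : 'rV[R]_n) : 'rV[R]_n.+1 :=
  \row_i (if unlift ord0 i is Some j then v 0 j else x).

Lemma row_cons0 n x (v : 'rV[R]_n) : row_cons x v 0 ord0 = x.
Proof. by rewrite mxE unlift_none. Qed.

Lemma row_consS n x (v : 'rV[R]_n) j : row_cons x v 0 (lift ord0 j) = v 0 j.
Proof. by rewrite mxE liftK. Qed.

Lemma row_consD n x y (v w : 'rV[R]_n) :
  row_cons x v + row_cons y w = row_cons (x + y) (v + w).
Proof. by apply/rowP => i; rewrite !mxE; case: unliftP => [j|]//; rewrite !mxE. Qed.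

Lemma row_cons_eta n (v : 'rV[R]_n.+1) :
  row_cons (v 0 ord0) (\row_j v 0 (lift ord0 j)) = v.
Proof.
by apply/rowP => i; rewrite !mxE; case: unliftP => [j ->|->]//; rewrite !mxE.
Qed.

Lemma dot_cons n x y (v w : 'rV[R]_n) :
  dot (row_cons x v) (row_cons y w) = x * y + dot v w.
Proof.
rewrite /dot big_ord_recl !row_cons0; congr (_ + _).
by apply: eq_bigr => j _; rewrite !row_consS.
Qed.

Lemma measurable_row_cons n :
  measurable_fun setT (fun p : measurableTypeR R * borel 'rV[R]_n =>
    row_cons p.1 p.2 : borel 'rV[R]_n.+1).
Proof.
apply: measurable_fun_row => i.
case: (unliftP ord0 i) => [j ->|->].
  under eq_fun do rewrite row_consS.
  by apply: (measurableT_comp (measurable_coord j)).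
under eq_fun do rewrite row_cons0.
exact: measurable_fst.
Qed.

Definition row_cons_pair n (p : measurableTypeR R * borel 'rV[R]_n) : borel 'rV[R]_n.+1 :=
  row_cons p.1 p.2.

HB.instance Definition _ n :=
  @isMeasurableFun.Build _ _ _ _ (@row_cons_pair n) (@measurable_row_cons n).

(** The law of n independent standard normal variables, built one coordinate at a
    time so that its properties follow by induction on the dimension. *)
Fixpoint gauss n : probability (borel 'rV[R]_n) R :=
  match n with
  | 0 => @dirac _ (borel 'rV[R]_0) (0 : 'rV[R]_0) R
  | n'.+1 => distribution (normal_prob 0 1 \x gauss n')%E (@row_cons_pair n')
  end.

Local Open Scope ereal_scope.

Lemma integral_gaussS n (f : borel 'rV[R]_n.+1 -> \bar R) :
  measurable_fun setT f -> (forall w, 0 <= f w) ->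
  \int[gauss n.+1]_w f w =
  \int[normal_prob 0 1]_x \int[gauss n]_v f (row_cons x v).
Proof.
move=> mf f0.
rewrite ge0_integral_distribution//=.
rewrite (fubini_tonelli1 (fun p : measurableTypeR R * borel 'rV[R]_n =>
  f (row_cons p.1 p.2)))//.
by apply: (measurableT_comp mf); exact: measurable_row_cons.
Qed.

End BorelRow.

(** * The Cameron-Martin formula *)

Section CameronMartin.
Variables (R : realType).
Local Notation gauss := (@gauss R).

Lemma measurable_dot n (t : 'rV[R]_n) :
  measurable_fun setT (fun w : borel 'rV[R]_n => dot t (w : 'rV[R]_n)).
Proof.
apply: measurable_sum => i; apply: measurable_funM => //.
exact: measurable_coord.
Qed.

Lemma measurable_row_shift n (t : 'rV[R]_n) :
  measurable_fun setT (fun w : borel 'rV[R]_n => (w : 'rV[R]_n) + t : borel 'rV[R]_n).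
Proof.
apply: measurable_fun_row => i; under eq_fun do rewrite mxE.
by apply: measurable_funD => //; exact: measurable_coord.
Qed.

(** The density of the law of w + t with respect to that of w, for w standard
    Gaussian. *)
Definition tilt n (t w : 'rV[R]_n) : R := expR (dot t w - dot t t / 2).

Lemma measurable_tilt n (t : 'rV[R]_n) :
  measurable_fun setT (fun w : borel 'rV[R]_n => tilt t (w : 'rV[R]_n)).
Proof.
rewrite /tilt; apply: measurableT_comp => //.
apply: measurable_funB => //; exact: measurable_dot.
Qed.

(** Induction on the dimension: the one-dimensional formula in the first coordinate
    and the induction hypothesis in the others, the density being a product. *)
Lemma cameron_martin n (t : 'rV[R]_n) (f : borel 'rV[R]_n -> \bar R) :
  measurable_fun setT f -> (forall w, 0 <= f w)%E ->
  (\int[gauss n]_w f ((w : 'rV[R]_n) + t)%R =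
   \int[gauss n]_w (f w * (tilt t (w : 'rV[R]_n))%:E))%E.
Proof.
elim: n t f => [|n IH] t f mf f0.
  have mft : measurable_fun setT (fun w : borel 'rV[R]_0 => f ((w : 'rV[R]_0) + t)%R).
    exact: (measurableT_comp mf (measurable_row_shift t)).
  have mfe : measurable_fun setT (fun w : borel 'rV[R]_0 => f w * (tilt t (w : 'rV[R]_0))%:E)%E.
    by apply: emeasurable_funM => //; apply/measurable_EFinP; exact: measurable_tilt.
  rewrite !integral_dirac// diracT !mul1e (thinmx0 t) addr0 /tilt /dot !big_ord0.
  by rewrite mul0r subr0 expR0 mule1.
have mft : measurable_fun setT (fun w : borel 'rV[R]_n.+1 => f ((w : 'rV[R]_n.+1) + t)%R).
  exact: (measurableT_comp mf (measurable_row_shift t)).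
have mfe : measurable_fun setT (fun w : borel 'rV[R]_n.+1 => f w * (tilt t (w : 'rV[R]_n.+1))%:E)%E.
  by apply: emeasurable_funM => //; apply/measurable_EFinP; exact: measurable_tilt.
rewrite !integral_gaussS//; last by move=> w; rewrite mule_ge0// lee_fin expR_ge0.
pose t0 : R := t 0 ord0; pose t' : 'rV[R]_n := \row_j t 0 (lift ord0 j).
have tE : t = row_cons t0 t' by rewrite row_cons_eta.
pose g (p : measurableTypeR R * borel 'rV[R]_n) : \bar R :=
  (f (row_cons p.1 p.2) * (tilt t' (p.2 : 'rV[R]_n))%:E)%E.
have mg : measurable_fun setT g.
  apply: emeasurable_funM.
    by apply: (measurableT_comp mf); exact: measurable_row_cons.
  by apply/measurable_EFinP; exact: (measurableT_comp (measurable_tilt t')).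
have g0 p : (0 <= g p)%E by rewrite mule_ge0// lee_fin expR_ge0.
pose G (x : R) : \bar R := (\int[gauss n]_v g (x, v))%E.
have mfx x : measurable_fun setT (fun v : borel 'rV[R]_n => f (row_cons x v)).
  have mp : measurable_fun setT
      (fun v : borel 'rV[R]_n => (x, v) : measurableTypeR R * borel 'rV[R]_n).
    exact: measurable_fun_pair.
  exact: (measurableT_comp mf (measurableT_comp (measurable_row_cons (n := n)) mp)).
transitivity (\int[normal_prob 0 1]_x G (x + t0)%R)%E.
  apply: eq_integral => x _; rewrite /G /g /=.
  rewrite -(IH _ (fun v => f (row_cons (x + t0) v)))//.
  by apply: eq_integral => v _; rewrite tE row_consD.
rewrite (@gauss_shift R t0 G).
- apply: eq_integral => x _; rewrite /G -ge0_integralZr//.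
  + apply: eq_integral => v _; rewrite /g/= -muleA -EFinM; congr (_ * _%:E)%E.
    by rewrite /tilt -expRD tE !dot_cons; congr expR; field.
  + by apply: (measurableT_comp mg); exact: measurable_fun_pair.
- exact: (@measurable_fun_fubini_tonelli_F _ _ _ _ _ (gauss n) _ mg).
- by move=> x; apply: integral_ge0.
Qed.

Lemma integral_tilt n (t : 'rV[R]_n) :
  (\int[gauss n]_w (tilt t (w : 'rV[R]_n))%:E = 1)%E.
Proof.
have := @cameron_martin n t (cst 1%E) (measurable_cst _) (fun=> lee01).
rewrite integral_cst//= probability_setT mul1e => ->.
by apply: eq_integral => w _; rewrite mul1e.
Qed.

Lemma integral_exp_dot n (t : 'rV[R]_n) :
  (\int[gauss n]_w (expR (dot t (w : 'rV[R]_n)))%:E = (expR (dot t t / 2))%:E)%E.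
Proof.
rewrite -[RHS]mule1 -(integral_tilt t) -ge0_integralZl_EFin ?expR_ge0//.
- apply: eq_integral => w _; rewrite -EFinM /tilt -expRD; congr (expR _)%:E.
  by rewrite addrC subrK.
- by move=> w _; rewrite lee_fin expR_ge0.
- by apply/measurable_EFinP; exact: measurable_tilt.
Qed.

(** The square of the density of a translation by t is exp |t|^2 times the density
    of the translation by 2 t. *)
Lemma integral_tilt2 n (t : 'rV[R]_n) :
  (\int[gauss n]_w (tilt t (w : 'rV[R]_n) ^+ 2)%:E = (expR (dot t t))%:E)%E.
Proof.
rewrite -[RHS]mule1 -(integral_tilt (2 *: t)) -ge0_integralZl_EFin ?expR_ge0//.
- apply: eq_integral => w _; rewrite -EFinM /tilt -expRD -expRM_natl; congr (expR _)%:E.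
  by rewrite !dotZl !dotZr; field.
- by move=> w _; rewrite lee_fin expR_ge0.
- by apply/measurable_EFinP; exact: measurable_tilt.
Qed.

End CameronMartin.

(** * Moments of linear forms *)

Section Moments.
Variables (R : realType) (n : nat).
Local Notation gauss := (@gauss R n).
Implicit Types c w : 'rV[R]_n.

Lemma expR_le1D2 (y : R) : 0 <= y -> y <= 2^-1 -> expR y <= 1 + 2 * y.
Proof.
move=> y0 y1; have : 1 - y <= expR (- y) by exact: expR_ge1Dx.
rewrite expRN => h; have e0 := expR_gt0 y.
have : (1 - y) * expR y <= 1 by rewrite -ler_pdivlMr// mul1r.
nra.
Qed.

Lemma sqr_le_exp (x : R) : x ^+ 2 <= 4 * (expR x + expR (- x)).
Proof.
have H (y : R) : 0 <= y -> y ^+ 2 <= 4 * expR y.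
  move=> y0; have : 1 + y / 2 <= expR (y / 2) by exact: expR_ge1Dx.
  have -> : expR y = expR (y / 2) ^+ 2 by rewrite -expRM_natl; congr expR; field.
  nra.
have e1 := expR_ge0 x; have e2 := expR_ge0 (- x).
have [x0|x0] := leP 0 x; first by have := H _ x0; lra.
by have := H (- x); rewrite sqrrN oppr_ge0 => /(_ (ltW x0)); lra.
Qed.

Lemma mexp_dot c : measurable_fun setT (fun w : borel 'rV[R]_n => (expR (dot c (w : 'rV[R]_n)))%:E).
Proof.
by apply/measurable_EFinP; apply: measurableT_comp => //; exact: measurable_dot.
Qed.

(** For a unit vector c, <c, w>^2 <= 4 (exp <c, w> + exp (- <c, w>)) has expectation
    at most 8 exp (1/2) <= 16. The exact value is |c|^2; a universal factor is
    harmless. *)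
Lemma gauss_dot_sqr_le c :
  (\int[gauss]_w ((dot c (w : 'rV[R]_n)) ^+ 2)%:E <= (16 * dot c c)%:E)%E.
Proof.
have mX c' : measurable_fun setT (fun w : borel 'rV[R]_n => ((dot c' (w : 'rV[R]_n)) ^+ 2)%:E).
  by apply/measurable_EFinP; apply: measurable_funX; exact: measurable_dot.
have unit c' : dot c' c' = 1 -> (\int[gauss]_w ((dot c' (w : 'rV[R]_n)) ^+ 2)%:E <= 16%:E)%E.
  move=> c1.
  apply: (@le_trans _ _ (\int[gauss]_w (4%:E * ((expR (dot c' (w : 'rV[R]_n)))%:E +
       (expR (dot (- c') (w : 'rV[R]_n)))%:E)))%E).
    apply: ge0_le_integral => //.
    - by move=> w _; rewrite lee_fin sqr_ge0.
    - by apply: measurable_funeM; apply: emeasurable_funD; exact: mexp_dot.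
    - by move=> w _; rewrite -EFinD -EFinM lee_fin dotNl; exact: sqr_le_exp.
  rewrite ge0_integralZl_EFin//; first last.
  - by apply: emeasurable_funD; exact: mexp_dot.
  - by move=> w _; rewrite -EFinD lee_fin addr_ge0// expR_ge0.
  rewrite ge0_integralD//; first last.
  - exact: mexp_dot.
  - exact: mexp_dot.
  rewrite !integral_exp_dot dotNN c1 -EFinD -EFinM lee_fin.
  have : expR 2^-1 <= 2 :> R.
    by apply: (le_trans (expR_le1D2 _ _)); lra.
  by rewrite mul1r => h; lra.
have [c0|c0] := eqVneq (dot c c) 0.
  rewrite c0 mulr0 integral0_eq// => w _.
  by rewrite (dot_eq0 c0) dot0l expr0n.
have cp : 0 < dot c c by rewrite lt_neqAle eq_sym c0 dot_ge0.
pose s := Num.sqrt (dot c c); have s0 : 0 < s by rewrite sqrtr_gt0.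
have sE : s ^+ 2 = dot c c by rewrite sqr_sqrtr// ltW.
have u1 : dot (s^-1 *: c) (s^-1 *: c) = 1.
  by rewrite dotZl dotZr -sE; field; rewrite gt_eqF.
rewrite (_ : (\int[gauss]_w _)%E = (\int[gauss]_w ((s ^+ 2)%:E * ((dot (s^-1 *: c) (w : 'rV[R]_n)) ^+ 2)%:E)))%E; last first.
  apply: eq_integral => w _; rewrite -EFinM dotZl; congr EFin.
  by field; rewrite gt_eqF.
rewrite ge0_integralZl_EFin ?sqr_ge0//; last by move=> w _; rewrite lee_fin sqr_ge0.
rewrite (mulrC 16) -sE [leRHS]EFinM lee_wpmul2l ?lee_fin ?sqr_ge0//.
exact: unit.
Qed.

Lemma gauss_dot_integrable c :
  gauss.-integrable setT (fun w : borel 'rV[R]_n => (dot c (w : 'rV[R]_n))%:E).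
Proof.
have mX : measurable_fun setT (fun w : borel 'rV[R]_n => (dot c (w : 'rV[R]_n))%:E).
  by apply/measurable_EFinP; exact: measurable_dot.
apply/integrableP; split => //.
apply: (@le_lt_trans _ _ (\int[gauss]_w (1%:E + ((dot c (w : 'rV[R]_n)) ^+ 2)%:E))%E).
  apply: ge0_le_integral => //.
  - exact: measurableT_comp.
  - apply: emeasurable_funD => //.
    by apply/measurable_EFinP; apply: measurable_funX; exact: measurable_dot.
  - move=> w _; rewrite -EFinD lee_fin; set x := dot c w.
    by rewrite ler_norml; nra.
rewrite ge0_integralD//; first last.
- by apply/measurable_EFinP; apply: measurable_funX; exact: measurable_dot.
- by move=> w _; rewrite lee_fin sqr_ge0.
rewrite integral_cst//= probability_setT mule1 lte_add_pinfty ?ltry//.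
exact: le_lt_trans (gauss_dot_sqr_le c) (ltry _).
Qed.

(** With m the mean and q = |c|^2, the inequality
    1 + s m <= E exp (s <c, w>) = exp (s^2 q / 2) <= 1 + s^2 q for all small s > 0
    forces m <= 0; apply it to c and - c. *)
Lemma gauss_dot_mean c : (\int[gauss]_w (dot c (w : 'rV[R]_n))%:E = 0)%E.
Proof.
have neg c' : (\int[gauss]_w (dot c' (w : 'rV[R]_n))%:E <= 0)%E.
  have fi := gauss_dot_integrable c'.
  have mfin := integrable_fin_num measurableT fi.
  rewrite -(fineK mfin) lee_fin; set m := fine _; rewrite leNgt; apply/negP => m0.
  pose q := dot c' c'; have q0 : 0 <= q by exact: dot_ge0.
  (* Small enough for s q < m and s^2 q <= 1. *)
  pose s := m / ((1 + m) * (1 + q)).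
  have s0 : 0 < s by rewrite divr_gt0// mulr_gt0//; lra.
  have sE : s * ((1 + m) * (1 + q)) = m by rewrite /s mulfVK// gt_eqF// mulr_gt0//; lra.
  have : (1 + s * m <= expR (s ^+ 2 * q / 2)).
    rewrite -lee_fin.
    have -> : (s ^+ 2 * q / 2) = dot (s *: c') (s *: c') / 2.
      by rewrite dotZl dotZr mulrA -expr2.
    rewrite -integral_exp_dot.
    have -> : (1 + s * m)%:E = (\int[gauss]_w (1 + s%:E * (dot c' (w : 'rV[R]_n))%:E))%E.
      rewrite integralD//; first last.
      - exact: integrableZl.
      - exact: finite_measure_integrable_cst.
      rewrite integral_cst//= probability_setT mule1 integralZl//.
      by rewrite -(fineK mfin) -EFinM -EFinD.
    apply: le_integral => //.
    - apply: integrableD => //; last exact: integrableZl.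
      exact: finite_measure_integrable_cst.
    - apply/integrableP; split; first exact: mexp_dot.
      under eq_integral => w _ do rewrite gee0_abs ?lee_fin ?expR_ge0//.
      by rewrite integral_exp_dot ltry.
    - by move=> w _; rewrite -EFinM -EFinD lee_fin dotZl; exact: expR_ge1Dx.
  have b1 : s * (1 + q) <= 1 by nra.
  have : expR (s ^+ 2 * q / 2) <= 1 + 2 * (s ^+ 2 * q / 2).
    apply: expR_le1D2; nra.
  nra.
apply/eqP; rewrite eq_le neg/=.
have := neg (- c); rewrite (_ : integral _ _ _ = - \int[gauss]_w (dot c (w : 'rV[R]_n))%:E)%E.
  by rewrite oppe_le0.
under eq_integral do rewrite dotNl EFinN.
by rewrite integralN// (integrable_add_def _ (gauss_dot_integrable c)).
Qed.

End Moments.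

(** * Differentiability from a quadratic remainder *)

Lemma quadratic_remainder_diff (R : realType) (V W : normedModType R) (f : V -> W)
    (df : {linear V -> W}) (x : V) (C : R) :
  continuous df -> 0 <= C ->
  (forall h, `|f (h + x) - f x - df h| <= C * `|h| ^+ 2) ->
  differentiable f x /\ 'd f x = df :> (V -> W).
Proof.
move=> dfc C0 fC.
have H : f \o shift x = cst (f x) + df +o_ 0 id.
  have C1 : 0 < C + 1 by lra.
  apply/eqaddoP => _/posnumP[e]; near=> h.
  have hs : `|h| <= e%:num / (C + 1).
    near: h.
    by apply: nbhs0_le; rewrite divr_gt0.
  rewrite /= -[X in `|X|]/(f (h + x) - (f x + df h)) opprD addrA.
  apply: (le_trans (fC h)).
  have : `|h| * (C + 1) <= e%:num by rewrite -ler_pdivlMr.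
  by have := normr_ge0 h; nra.
have dE : 'd f x = df :> (V -> W) by exact: diff_unique.
by split => //; apply/diff_locallyP; rewrite dE.
Unshelve. all: by end_near.
Qed.

Section Remainder.
Variables (R : realType) (n : nat).
Implicit Types (x y : 'rV[R]_n.+1).

Lemma dot_is_linear (c : 'rV[R]_n.+1) : linear (dot c : 'rV[R]_n.+1 -> R^o).
Proof. by move=> a x y; rewrite dotDr dotZr. Qed.

HB.instance Definition _ c := GRing.isLinear.Build R 'rV[R]_n.+1 R^o _ (dot c) (dot_is_linear c).

Lemma dot_le_norm x : dot x x <= n.+1%:R * `|x| ^+ 2.
Proof.
apply: (@le_trans _ _ (\sum_(i < n.+1) `|x| ^+ 2)); last first.
  by rewrite sumr_const card_ord mulr_natl.
apply: ler_sum => i _.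
rewrite -expr2 -real_normK ?num_real// lerXn2r ?nnegrE//.
rewrite [leRHS]mx_normrE; exact: (le_bigmax _ (fun ij => `|x ij.1 ij.2|) (0, i)).
Qed.

Lemma dot_continuous c : continuous (dot c : 'rV[R]_n.+1 -> R).
Proof.
rewrite /dot; elim: (index_enum _) => [|i s IH].
  rewrite (_ : (fun _ => _) = cst 0); first exact: cst_continuous.
  by apply/funext => x; rewrite big_nil.
rewrite (_ : (fun _ => _) = fun x => c 0 i * x 0 i + \sum_(j <- s) c 0 j * x 0 j).
  move=> x; apply: (@cvgD _ _ _ (nbhs x)); last exact: IH.
  apply: (@cvgM R _ (nbhs x)); first exact: cvg_cst.
  exact: coord_continuous.
by apply/funext => x; rewrite big_cons.
Qed.

(** A remainder bounded by the squared norm gives both differentiability and the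
    value of the gradient, which spares any computation of derivatives for the
    instances below. *)
Lemma remainder_diff (g : 'rV[R]_n.+1 -> R) (c x : 'rV[R]_n.+1) (K : R) :
  (forall h, `|g (h + x) - g x - dot c h| <= K * dot h h) ->
  differentiable g x /\ grad g x = c.
Proof.
move=> gK.
have [||dg dE] := @quadratic_remainder_diff R 'rV[R]_n.+1 R^o g
    (dot c : 'rV[R]_n.+1 -> R^o) x (`|K| * n.+1%:R) (@dot_continuous c).
- by rewrite mulr_ge0.
- move=> h; apply: (le_trans (gK h)); rewrite -mulrA.
  apply: (@le_trans _ _ (`|K| * dot h h)).
    by rewrite ler_wpM2r ?dot_ge0 ?ler_norm.
  by rewrite ler_wpM2l ?dot_le_norm.
- split => //; apply/rowP => i; rewrite mxE deriveE//.
  rewrite dE -[LHS]/(dot c (delta_mx 0 i)) /dot (bigD1 i)//= big1 ?addr0.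
    by rewrite mxE !eqxx mulr1.
  by move=> j ji; rewrite mxE eqxx (negbTE ji) mulr0.
Qed.

End Remainder.

(** * Separable functions *)

Section Separable.
Variables (R : realType) (n : nat).
Variables (phi gam : 'I_n.+1 -> R -> R) (K : R).
Hypothesis K0 : 0 <= K.
(* gam i is the derivative of phi i, given through a quadratic remainder. *)
Hypothesis phiK : forall i y z,
  `|phi i y - phi i z - gam i z * (y - z)| <= K * (y - z) ^+ 2.

Definition separable (x : 'rV[R]_n.+1) : R := \sum_i phi i (x 0 i).

Lemma separable_remainder (x y : 'rV[R]_n.+1) :
  separable y - separable x - dot (\row_i gam i (x 0 i)) (y - x) =
  \sum_i (phi i (y 0 i) - phi i (x 0 i) - gam i (x 0 i) * (y 0 i - x 0 i)).
Proof.
rewrite /separable /dot !sumrB; congr (_ - _).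
by apply: eq_bigr => i _; rewrite !mxE.
Qed.

Lemma separable_diff x :
  differentiable separable x /\ grad separable x = \row_i gam i (x 0 i).
Proof.
apply: (@remainder_diff _ _ _ _ _ K) => h.
move: (h + x) (esym (addrK x h)) => y ->.
rewrite separable_remainder dotBE mulr_sumr.
by apply: le_trans (ler_norm_sum _ _ _) _; apply: ler_sum => i _; exact: phiK.
Qed.

(** Adding the bounds on the remainders at z and at y shows that the product of
    gam y - gam z and y - z is at most 2 K (y - z)^2 in absolute value. *)
Lemma gam_lip i y z : (gam i y - gam i z) ^+ 2 <= (2 * K) ^+ 2 * (y - z) ^+ 2.
Proof.
have := phiK i y z; have := phiK i z y.
rewrite -(opprB y z) sqrrN mulrN opprK !ler_norml => /andP[a1 a2] /andP[b1 b2].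
set D := gam i y - gam i z; set e := y - z in a1 a2 b1 b2 *.
have h1 : D * e <= 2 * K * e ^+ 2 by rewrite /D; nra.
have h2 : - (2 * K * e ^+ 2) <= D * e by rewrite /D; nra.
have [e0|e0] := eqVneq e 0.
  have yz : y = z by apply/eqP; rewrite -subr_eq0 -/e e0.
  by rewrite /D yz subrr expr0n/= mulr_ge0// sqr_ge0.
have e2 : 0 < e ^+ 2 by rewrite exprn_even_gt0.
rewrite -(ler_pM2r e2) -exprMn.
rewrite -[leLHS]real_normK ?num_real//.
have -> : (2 * K) ^+ 2 * e ^+ 2 * e ^+ 2 = (2 * K * e ^+ 2) ^+ 2 by ring.
have c0 : 0 <= 2 * K * e ^+ 2 by rewrite mulr_ge0 ?sqr_ge0// mulr_ge0.
by rewrite lerXn2r ?nnegrE// ler_norml h1 h2.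
Qed.

Lemma separable_lipschitz : lipschitz_gradient (2 * K + 1) separable.
Proof.
split=> [x|x y]; first by have [] := separable_diff x.
rewrite (separable_diff x).2 (separable_diff y).2 /enorm.
have K2 : 0 <= 2 * K by rewrite mulr_ge0.
have L0 : 0 <= 2 * K + 1 by rewrite addr_ge0.
rewrite -[X in X * _]ger0_norm// -sqrtr_sqr -sqrtrM ?sqr_ge0//.
apply: ler_wsqrtr; rewrite !dotBE mulr_sumr; apply: ler_sum => i _; rewrite !mxE.
apply: (le_trans (gam_lip _ _ _)); rewrite ler_wpM2r ?sqr_ge0//.
by rewrite lerXn2r ?nnegrE// lerDl.
Qed.

(** The remainder of a separable function is the sum of those of its coordinates. *)
Lemma separable_convex (mu : R) :
  (forall i y z, mu / 2 * (y - z) ^+ 2 <= phi i y - phi i z - gam i z * (y - z)) ->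
  strongly_convex mu separable.
Proof.
move=> phimu; split=> [x|x y]; first by have [] := separable_diff x.
rewrite (separable_diff y).2 separable_remainder enorm_sqr dotBE mulr_sumr.
by apply: ler_sum => i _; exact: phimu.
Qed.

Lemma separable_minimizer (mu : R) (xs : 'rV[R]_n.+1) : 0 <= mu ->
  strongly_convex mu separable -> (forall i, gam i (xs 0 i) = 0) ->
  is_minimizer separable xs.
Proof.
move=> mu0 [_ scv] gx x; have := scv x xs; rewrite (separable_diff xs).2.
have -> : dot (\row_i gam i (xs 0 i)) (x - xs) = 0.
  by rewrite /dot big1// => i _; rewrite !mxE gx mul0r.
rewrite subr0 => H; rewrite -subr_ge0; apply: le_trans H.
by rewrite mulr_ge0 ?sqr_ge0// divr_ge0.
Qed.

End Separable.

(** * Noisy objectives with a hidden sign vector *)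

Section Instances.
Variables (R : realType) (n : nat).
Variables (b c : {nonneg R}) (bc1 : b%:num + c%:num = 1) (c0 : 0 < c%:num).
Notation M := (lazy_source (@gauss R n.+1) bc1 c0).
Variables (mu : R) (mu0 : 0 < mu) (eta deta : R -> R).
Hypothesis etaK : forall y z,
  `|eta y - eta z - deta z * (y - z)| <= mu / 2 * (y - z) ^+ 2.
Hypothesis meta : measurable_fun setT eta.
Variable v : {ffun 'I_n.+1 -> bool}.

Definition sgnv (v : {ffun 'I_n.+1 -> bool}) (i : 'I_n.+1) : R := (-1) ^+ v i.

Definition target_phi i y : R := mu * y ^+ 2 - sgnv v i * eta y.
Definition target_gam i y : R := 2 * mu * y - sgnv v i * deta y.
Definition target : 'rV[R]_n.+1 -> R := separable target_phi.

Lemma sgnv_norm i : `|sgnv v i| = 1.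
Proof. by rewrite /sgnv normrX normrN1 expr1n. Qed.

(** The square has remainder mu (y - z)^2, and that of eta is at most half of it. *)
Lemma target_remainder i y z :
  mu / 2 * (y - z) ^+ 2 <= target_phi i y - target_phi i z - target_gam i z * (y - z)
    <= 3 / 2 * mu * (y - z) ^+ 2.
Proof.
have E : target_phi i y - target_phi i z - target_gam i z * (y - z) =
  mu * (y - z) ^+ 2 - sgnv v i * (eta y - eta z - deta z * (y - z)).
  by rewrite /target_phi /target_gam; ring.
rewrite E; have := etaK y z.
have : `|sgnv v i * (eta y - eta z - deta z * (y - z))| =
  `|eta y - eta z - deta z * (y - z)| by rewrite normrM sgnv_norm mul1r.
set r := sgnv v i * _; move=> <-; rewrite ler_norml => /andP[h1 h2].
by apply/andP; split; lra.
Qed.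

Lemma target_remainder_norm i y z :
  `|target_phi i y - target_phi i z - target_gam i z * (y - z)| <= 3 / 2 * mu * (y - z) ^+ 2.
Proof.
have /andP[h1 h2] := target_remainder i y z.
rewrite ger0_norm//; apply: le_trans h1; rewrite mulr_ge0 ?sqr_ge0// divr_ge0//.
exact: ltW.
Qed.

Let K0 : 0 <= 3 / 2 * mu.
Proof. by rewrite mulr_ge0// ltW. Qed.

Lemma target_convex : strongly_convex mu target.
Proof.
apply: (@separable_convex _ _ _ target_gam _ target_remainder_norm) => i y z.
by have /andP[] := target_remainder i y z.
Qed.

(** By symmetry of deta the derivative at v_i a is v_i (2 mu a - deta a). *)
Lemma target_minimizer (a : R) : 2 * mu * a = deta a -> deta (- a) = deta a ->
  is_minimizer target (\row_i (sgnv v i * a)).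
Proof.
move=> aE aN.
apply: (@separable_minimizer _ _ _ target_gam _ target_remainder_norm mu _ (ltW mu0) target_convex) => i.
by rewrite mxE /target_gam /sgnv; case: (v i); rewrite ?expr1 ?expr0 ?mulN1r ?mul1r ?aN -aE; ring.
Qed.

Lemma measurable_target : measurable_fun setT (fun x : borel 'rV[R]_n.+1 => target (x : 'rV[R]_n.+1)).
Proof.
apply: measurable_sum => i.
have mi := @measurable_coord R n.+1 i.
rewrite /target_phi; apply: measurable_funB; apply: measurable_funM => //.
  exact: measurable_funX.
exact: (measurableT_comp meta).
Qed.

Variable cf : 'rV[R]_n.+1 -> 'rV[R]_n.+1.
Hypothesis mcf : forall i, measurable_fun setT (fun x : borel 'rV[R]_n.+1 => cf (x : 'rV[R]_n.+1) 0 i).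

(** The noise is linear in the state, with a coefficient vector cf x that depends
    on the query; it has mean zero, so the objective is the target. *)
Definition noisy (x : 'rV[R]_n.+1) (z : state M) : R := target x + dot (cf x) (z : 'rV[R]_n.+1).

Lemma integral_noisy x :
  (\int[stat_law M]_z (noisy x z)%:E = (target x)%:E)%E /\
  (stat_law M).-integrable setT (fun z => (noisy x z)%:E).
Proof.
have i1 : (@gauss R n.+1).-integrable setT (fun z : borel 'rV[R]_n.+1 => (target x)%:E).
  exact: finite_measure_integrable_cst.
have i2 := @gauss_dot_integrable R n.+1 (cf x).
split; last first.
  exact: (integrableD measurableT i1 i2).
transitivity (\int[@gauss R n.+1]_z ((target x)%:E + (dot (cf x) (z : 'rV[R]_n.+1))%:E))%E.
  exact: eq_integral.
rewrite integralD// gauss_dot_mean adde0.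
by rewrite integral_cst//= probability_setT mule1.
Qed.

Lemma objective_noisy : objective noisy = target.
Proof. by apply/funext => x; rewrite /objective /Rintegral (integral_noisy x).1. Qed.

Lemma noisy_well_posed : well_posed noisy.
Proof.
split=> [|x]; last exact: (integral_noisy x).2.
apply: measurable_funD.
  exact: (measurableT_comp measurable_target).
apply: measurable_sum => i; apply: measurable_funM.
  exact: (measurableT_comp (mcf i)).
exact: (measurableT_comp (@measurable_coord R n.+1 i)).
Qed.

Lemma noisy_one_point tau sigma : (0 < tau)%N -> b%:num ^+ tau <= 4^-1 ->
  (forall x, 16 * dot (cf x) (cf x) <= sigma ^+ 2) ->
  one_point_instance tau mu sigma noisy.
Proof.
move=> tau0 btau cfs; split.
- exact: lazy_mixing.
- exact: noisy_well_posed.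
- exists (2 * (3 / 2 * mu) + 1); first by rewrite ltr_wpDl// mulr_ge0.
  rewrite objective_noisy.
  exact: (@separable_lipschitz _ _ _ target_gam _ K0 target_remainder_norm).
- by rewrite objective_noisy; exact: target_convex.
- move=> x; rewrite objective_noisy.
  apply: (@le_trans _ _ (16 * dot (cf x) (cf x))%:E); last by rewrite lee_fin.
  apply: le_trans (gauss_dot_sqr_le (cf x)).
  rewrite le_eqVlt; apply/orP; left; apply/eqP.
  apply: eq_integral => z _; rewrite /noisy addrAC subrr add0r.
  by rewrite real_normK ?num_real.
Qed.

End Instances.

(** * Two-point instances *)

Section TwoPoint.
Variables (R : realType) (n : nat).
Variables (b c : {nonneg R}) (bc1 : b%:num + c%:num = 1) (c0 : 0 < c%:num).
Notation M := (lazy_source (@gauss R n.+1) bc1 c0).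
Variables (mu : R) (mu0 : 0 < mu) (be s : R) (v : {ffun 'I_n.+1 -> bool}).

Definition lin_eta (y : R) : R := be * y.

Lemma lin_etaK (y z : R) :
  `|lin_eta y - lin_eta z - be * (y - z)| <= mu / 2 * (y - z) ^+ 2.
Proof.
rewrite (_ : _ - _ = 0) ?normr0; last by rewrite /lin_eta; ring.
by rewrite mulr_ge0 ?sqr_ge0// divr_ge0// ltW.
Qed.

Lemma measurable_lin_eta : measurable_fun setT lin_eta.
Proof. exact: measurable_funM. Qed.

Definition lin_cf (x : 'rV[R]_n.+1) := s *: x.

Lemma measurable_lin_cf i :
  measurable_fun setT (fun x : borel 'rV[R]_n.+1 => lin_cf (x : 'rV[R]_n.+1) 0 i).
Proof.
rewrite /lin_cf; under eq_fun do rewrite mxE.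
by apply: measurable_funM => //; exact: measurable_coord.
Qed.

Notation F := (@noisy R n b c bc1 c0 mu lin_eta v lin_cf).

Let ph (z : 'rV[R]_n.+1) i y : R := target_phi mu lin_eta v i y + s * z 0 i * y.
Let ga (z : 'rV[R]_n.+1) i y : R := target_gam mu (fun=> be) v i y + s * z 0 i.

Let phK z i (y y' : R) : `|ph z i y - ph z i y' - ga z i y' * (y - y')| <= mu * (y - y') ^+ 2.
Proof.
rewrite /ph /ga /target_phi /target_gam /lin_eta (_ : _ - _ = mu * (y - y') ^+ 2); last by ring.
by rewrite ger0_norm// mulr_ge0 ?sqr_ge0// ltW.
Qed.

Let FE (z : state M) : F ^~ z = separable (ph z).
Proof.
apply/funext => x; rewrite /noisy /target /separable /dot -big_split/=.
by apply: eq_bigr => i _; rewrite /ph /lin_cf mxE mulrAC.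
Qed.

Let gradF (z : state M) x : grad (F ^~ z) x = \row_i ga z i (x 0 i).
Proof. by rewrite FE (separable_diff (phK z) x).2. Qed.

Let gradf x : grad (objective F) x = \row_i target_gam mu (fun=> be) v i (x 0 i).
Proof.
rewrite objective_noisy.
by rewrite (separable_diff (target_remainder_norm mu0 lin_etaK v) x).2.
Qed.

Let gi i : (@gauss R n.+1).-integrable setT (fun z : borel 'rV[R]_n.+1 => (s * (z : 'rV[R]_n.+1) 0 i)%:E).
Proof.
have := integrableZl measurableT s (gauss_dot_integrable (unit_row R i)).
by apply: eq_integrable => // z _; rewrite -dot_unitl.
Qed.

Let g0 i : (\int[@gauss R n.+1]_z (s * (z : 'rV[R]_n.+1) 0 i)%:E = 0)%E.
Proof.
rewrite (_ : integral _ _ _ = s%:E * \int[@gauss R n.+1]_z (dot (unit_row R i) (z : 'rV[R]_n.+1))%:E)%E.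
  by rewrite gauss_dot_mean mule0.
rewrite -integralZl//; last exact: gauss_dot_integrable.
by apply: eq_integral => z _; rewrite -dot_unitl EFinM.
Qed.

Let gint x i : (stat_law M).-integrable setT (fun z => (grad (F ^~ z) x 0 i)%:E).
Proof.
have i1 : (@gauss R n.+1).-integrable setT
    (fun z : borel 'rV[R]_n.+1 => (target_gam mu (fun=> be) v i (x 0 i))%:E).
  exact: finite_measure_integrable_cst.
have := integrableD measurableT i1 (gi i).
by apply: eq_integrable => // z _; rewrite gradF mxE.
Qed.

(** With noise s <x, z> the gradient of F at x is that of the target plus s z, and
    its variance is at most 16 s^2 per coordinate. *)
Lemma noisy_two_point tau sigma : (0 < tau)%N -> b%:num ^+ tau <= 4^-1 ->
  16 * s ^+ 2 * n.+1%:R <= sigma ^+ 2 ->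
  two_point_instance tau mu sigma F.
Proof.
move=> tau0 btau ssig.
have mu0' : 0 <= mu by exact: ltW.
split.
- exact: lazy_mixing.
- apply: noisy_well_posed; [exact: measurable_lin_eta|exact: measurable_lin_cf].
- exists (2 * mu + 1); first by rewrite ltr_wpDl// mulr_ge0.
  by move=> z; rewrite FE; exact: (separable_lipschitz mu0' (phK z)).
- by rewrite objective_noisy; exact: (target_convex mu0 lin_etaK).
- exact: gint.
- move=> x; rewrite gradf; apply/rowP => i; rewrite !mxE /Rintegral.
  rewrite (_ : integral _ _ _ = (target_gam mu (fun=> be) v i (x 0 i))%:E)//.
  transitivity (\int[@gauss R n.+1]_z ((target_gam mu (fun=> be) v i (x 0 i))%:E +
     (s * (z : 'rV[R]_n.+1) 0 i)%:E))%E.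
    by apply: eq_integral => z _; rewrite gradF mxE.
  rewrite integralD//; last exact: finite_measure_integrable_cst.
  by rewrite g0 adde0 integral_cst//= probability_setT mule1.
- move=> x.
  have mz i : measurable_fun setT (fun z : borel 'rV[R]_n.+1 => ((dot (unit_row R i) (z : 'rV[R]_n.+1)) ^+ 2)%:E).
    by apply/measurable_EFinP; apply: measurable_funX; exact: measurable_dot.
  apply: (@le_trans _ _ (\sum_(i < n.+1) (s ^+ 2)%:E * \int[@gauss R n.+1]_z
      ((dot (unit_row R i) (z : 'rV[R]_n.+1)) ^+ 2)%:E)%E).
    rewrite le_eqVlt; apply/orP; left; apply/eqP.
    transitivity (\sum_(i < n.+1) \int[@gauss R n.+1]_z ((s ^+ 2)%:E *
      ((dot (unit_row R i) (z : 'rV[R]_n.+1)) ^+ 2)%:E))%E; last first.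
      apply: eq_bigr => i _; rewrite ge0_integralZl_EFin ?sqr_ge0// => z _.
      by rewrite lee_fin sqr_ge0.
    rewrite -ge0_integral_sum//; first last.
    - by move=> i z _; rewrite -EFinM lee_fin mulr_ge0// sqr_ge0.
    - by move=> i; exact: measurable_funeM.
    apply: eq_integral => z _; rewrite gradF gradf enorm_sqr dotBE -sumEFin.
    apply: eq_bigr => i _; rewrite !mxE dot_unitl -EFinM /ga; congr EFin.
    by rewrite addrAC subrr add0r exprMn.
  apply: (@le_trans _ _ (\sum_(i < n.+1) (16 * s ^+ 2)%:E)%E).
    apply: lee_sum => i _; rewrite (mulrC 16) [leRHS]EFinM lee_wpmul2l ?lee_fin ?sqr_ge0//.
    apply: (le_trans (gauss_dot_sqr_le _)); rewrite unit_row_dot mulr1.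
    by [].
  by rewrite sumEFin lee_fin sumr_const card_ord -[_ *+ _]mulr_natr.
Qed.

End TwoPoint.

(** * Averaging over the hidden signs *)

Section Flip.
Variables (R : realType) (n : nat).
Definition flip (i : 'I_n) (v : {ffun 'I_n -> bool}) : {ffun 'I_n -> bool} :=
  [ffun j => if j == i then ~~ v j else v j].

Lemma flipK i : involutive (flip i).
Proof.
by move=> v; apply/ffunP => j; rewrite !ffunE; case: eqP => // _; rewrite negbK.
Qed.

Lemma flipE i v : flip i v i = ~~ v i.
Proof. by rewrite ffunE eqxx. Qed.
End Flip.

Lemma prod_1B_ge (R : realType) N (x : nat -> R) :
  (forall k, 0 <= x k <= 1) ->
  1 - \sum_(k < N) x k <= \prod_(k < N) (1 - x k).
Proof.
move=> x01; elim: N => [|N IH]; first by rewrite !big_ord0 subr0.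
rewrite !big_ord_recr/=; have /andP[x0 x1] := x01 N.
have S0 : 0 <= \sum_(k < N) x k by apply: sumr_ge0 => k _; have /andP[] := x01 k.
have p0 : 0 <= 1 - x N by rewrite subr_ge0.
apply: le_trans (ler_wpM2r p0 IH); nra.
Qed.

Section Assouad.
Variables (R : realType) (n : nat) (dX dO : measure_display).
Variables (X : measurableType dX) (O : measurableType dO).
Variables (A : algorithm R n.+1 X O).
Variables (b c : {nonneg R}) (bc1 : b%:num + c%:num = 1) (c0 : 0 < c%:num).
Notation M := (lazy_source (@gauss R n.+1) bc1 c0).
Notation pi := (@gauss R n.+1).
Notation T := (borel 'rV[R]_n.+1).
Notation Q := (lazy_kernel pi bc1).
Notation PE := (path_expectation Q).
Notation signs := {ffun 'I_n.+1 -> bool}.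
Variables (orc : signs -> X -> T -> O) (t : signs -> 'I_n.+1 -> X -> 'rV[R]_n.+1).
Notation q v i x := (dot (t v i x) (t v i x)).
Hypothesis morc : forall v, measurable_fun setT (fun p : X * T => orc v p.1 p.2).
Hypothesis orcE : forall v i x z,
  orc v x z = orc (flip i v) x ((z : 'rV[R]_n.+1) + t v i x).
Hypothesis mq : forall v i, measurable_fun setT (fun x => q v i x).
Hypothesis tc : b%:num = 0 \/ forall v i, exists t0, forall x, t v i x = t0.
Hypothesis q2 : forall v i x, q v i x <= 2^-1.
Variable Qs : R.
Hypothesis qS : forall v x, \sum_i q v i x <= Qs.
Variables (N : nat) (a : R).
Hypothesis a0 : 0 < a.
Hypothesis NQ : (1 + c%:num * N%:R) * Qs <= n.+1%:R / 4.

Let c1 : c%:num <= 1.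
Proof. by rewrite -bc1 lerDr. Qed.

(* The first state is always fresh; later ones are with probability c. *)
Let w (k : nat) : R := if k is 0 then 1 else c%:num.

Let w01 k : 0 <= w k <= 1.
Proof. by case: k => [|k] /=; rewrite ?lexx ?ler01//= c1 andbT. Qed.

Let rr v i k x : R := 1 - w k * q v i x.

Let wq01 v i k x : 0 <= w k * q v i x <= 2^-1.
Proof.
have /andP[h0 h1] := w01 k; have := q2 v i x; have := dot_ge0 (t v i x).
by move=> g0 g1; apply/andP; split; nra.
Qed.

Let rr_gt0 v i k x : 0 < rr v i k x.
Proof. by have /andP[_ h] := wq01 v i k x; rewrite /rr subr_gt0 (le_lt_trans h)// invf_lt1// ltr1n. Qed.

(* With y = w q this is (1 - y)^2 (1 + 2 y) <= 1, as exp q <= 1 + 2 q for q <= 1/2. *)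
Let rr_young v i k x : (rr v i k x) ^+ 2 * (1 - w k + w k * expR (q v i x)) <= 1.
Proof.
have /andP[h0 h1] := wq01 v i k x; have /andP[k0 k1] := w01 k.
have e := expR_le1D2 (dot_ge0 _) (q2 v i x).
rewrite /rr; set y := w k * q v i x in h0 h1 *.
have ye : 1 - w k + w k * expR (q v i x) <= 1 + 2 * y.
  by rewrite /y; nra.
apply: (le_trans (ler_wpM2l (sqr_ge0 _) ye)).
by nra.
Qed.

Definition guess_right v i (u : rand A) (h : seq O) : R :=
  (0 < sgnv R v i * output u h 0 i)%R%:R.

Let psi01 v i u h : 0 <= guess_right v i u h <= 1.
Proof. by rewrite /guess_right; case: (_ < _); rewrite /= ?lexx ler01. Qed.

Let mout i : history_measurable (fun (u : rand A) h => output u h 0 i).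
Proof.
move=> k; exact: (measurableT_comp (@measurable_coord R n.+1 i) (@output_measurable _ _ _ _ _ _ A k)).
Qed.

Let mpsi v i : history_measurable (guess_right v i).
Proof.
move=> k; rewrite /guess_right.
have mo : measurable_fun setT (fun p : rand A * k.-tuple O => sgnv R v i * output p.1 p.2 0 i).
  by apply: measurable_funM => //; exact: mout.
apply: (measurableT_comp (f := fun y : R => (0 < y)%R%:R : R) _ mo).
rewrite (_ : (fun _ => _) = \1_[set y : R | 0 < y]).
  by apply: measurable_indic; exact: open_measurable.
by apply/funext => y; rewrite indicE; congr (nat_of_bool _)%:R; apply/idP/idP; rewrite inE.
Qed.

Notation disc v i := (discount (A := A) (rr v i)).
Notation obs v := (observations (orc v)).
Let xs v : 'rV[R]_n.+1 := \row_i (sgnv R v i * a).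
Let Err v (u : rand A) h := (enorm (output u h - xs v) ^+ 2)%:E.
Let Phi v i (u : rand A) h := (disc v i u h * guess_right v i u h)%:E.
Let Psi v i (u : rand A) h := (guess_right v i u h)%:E.

(** [compare_runs] for the event that the i-th sign is guessed right, with
    lam = 1/2, so that the probability under the flipped vector enters with
    coefficient 1. *)
Lemma assouad_compare v i u :
  (PE pi N (fun zs => Phi v i u (obs v u [::] zs)) <=
   (4^-1)%:E + PE pi N (fun zs => Psi v i u (obs (flip i v) u [::] zs)))%E.
Proof.
have H := @compare_runs R n.+1 dX dO X O A _ T pi b c bc1 (orc v) (orc (flip i v))
  (fun x z => (z : 'rV[R]_n.+1) + t v i x) (fun x => tilt (t v i x))
  (fun x => expR (q v i x)) (rr v i) (morc v) (morc _) (orcE v i)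
  (fun x => measurable_row_shift (t v i x)) (fun x => measurable_tilt (t v i x)).
have -> : 4^-1 = 2^-1 / 2 :> R by field.
have : (2 * 2^-1)^-1 = 1 :> R by rewrite divff// invr1.
have := H _ _ _ _ _ _ _ (guess_right v i) (mpsi v i) (psi01 v i) u N 2^-1.
move=> + H1; rewrite H1 mul1e; apply => //.
- by move=> x y; exact: expR_gt0.
- by move=> x f f0 mf; exact: cameron_martin.
- by move=> x; rewrite integral_tilt2.
- by move=> k; apply: measurable_funB => //; exact: measurable_funM.
- by move=> x; have := rr_young v i 0 x; rewrite /= subrr add0r mul1r.
- by move=> k x; have := rr_young v i k.+1 x; rewrite /= -{1}bc1 addrK.
- case: tc => [->|/(_ v i)[t0 t0E]]; [by left|right].
  by exists (fun z => (z : 'rV[R]_n.+1) + t0) => x; apply/funext => z; rewrite t0E.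
Qed.

Let Qs0 (u : rand A) : 0 <= Qs.
Proof.
apply: le_trans (qS [ffun=> true] (query u [::])).
by apply: sumr_ge0 => i _; exact: dot_ge0.
Qed.

Let loss v i (u : rand A) h : R := \sum_(k < size h) w k * q v i (query u (take k h)).

Let disc_ge v i u h : 1 - loss v i u h <= disc v i u h.
Proof.
apply: (@prod_1B_ge _ (size h) (fun k => w k * q v i (query u (take k h)))) => k.
have /andP[-> h1] := wq01 v i k (query u (take k h)); apply: le_trans h1 _.
by rewrite invf_le1// ler1n.
Qed.

Let loss_sum v u h : size h = N -> \sum_i loss v i u h <= n.+1%:R / 4.
Proof.
move=> hN; apply: le_trans NQ.
rewrite /loss exchange_big/= hN.
apply: (@le_trans _ _ (\sum_(k < N) w k * Qs)).
  by apply: ler_sum => k _; rewrite -mulr_sumr ler_wpM2l// ?qS//; have /andP[] := w01 k.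
rewrite -mulr_suml ler_wpM2r ?(Qs0 u)//.
case: N => [|m]; first by rewrite big_ord0 mulr0 addr0.
rewrite big_ord_recl/= lerD2l sumr_const card_ord -[_ *+ m]mulr_natr ler_wpM2l//.
by rewrite ler_nat.
Qed.

Let sqr_wrong (s o : R) : `|s| = 1 -> s * o <= 0 -> a ^+ 2 <= (o - s * a) ^+ 2.
Proof.
move=> s1 so; have s2 : s ^+ 2 = 1 by rewrite -real_normK ?num_real// s1 expr1n.
have -> : (o - s * a) ^+ 2 = o ^+ 2 - 2 * a * (s * o) + s ^+ 2 * a ^+ 2 by ring.
have h : a * (s * o) <= 0 by rewrite pmulr_rle0.
by rewrite s2 mul1r; have := sqr_ge0 o; lra.
Qed.

Let right_ge v i u h : 1 - guess_right v i u h <= (output u h 0 i - xs v 0 i) ^+ 2 / a ^+ 2.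
Proof.
have a2 : 0 < a ^+ 2 by rewrite exprn_gt0.
rewrite /guess_right mxE; case: ltP => [_|so] /=.
  by rewrite subrr divr_ge0 ?sqr_ge0// ltW.
by rewrite subr0 ler_pdivlMr// mul1r sqr_wrong// sgnv_norm.
Qed.

Let right_flip v i u h : guess_right (flip i v) i u h <= (output u h 0 i - xs v 0 i) ^+ 2 / a ^+ 2.
Proof.
have a2 : 0 < a ^+ 2 by rewrite exprn_gt0.
rewrite /guess_right mxE; case: ltP => [so|_] /=; last first.
  by rewrite divr_ge0 ?sqr_ge0// ltW.
rewrite ler_pdivlMr// mul1r sqr_wrong ?sgnv_norm//.
move: so; rewrite /sgnv flipE; case: (v i); rewrite ?expr1 ?expr0 ?mulN1r ?mul1r.
  by move=> so; rewrite oppr_le0 ltW.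
by rewrite oppr_gt0 => /ltW.
Qed.

Let Err_sum v (u : rand A) h : enorm (output u h - xs v) ^+ 2 / a ^+ 2 =
  \sum_i (output u h 0 i - xs v 0 i) ^+ 2 / a ^+ 2.
Proof. by rewrite enorm_sqr dotBE mulr_suml. Qed.

(* For each coordinate, either the guess is right and the discount is at least
   1 - loss, or it is wrong and the squared error is at least a^2. *)
Let pointwise_right v (u : rand A) h : size h = N ->
  n.+1%:R * (3 / 4) <= \sum_i disc v i u h * guess_right v i u h
     + enorm (output u h - xs v) ^+ 2 / a ^+ 2.
Proof.
move=> hN; rewrite Err_sum -big_split/=.
apply: (@le_trans _ _ (\sum_(i < n.+1) (1 - loss v i u h))).
  rewrite sumrB sumr_const card_ord; have := loss_sum v u hN; set S := \sum_i _.
  by move=> SN; rewrite -[1 *+ _]/(n.+1%:R); lra.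
apply: ler_sum => i _.
have := right_ge v i u h; have := disc_ge v i u h; have /andP[g0 g1] := psi01 v i u h.
have l0 : 0 <= loss v i u h.
  by apply: sumr_ge0 => k _; have /andP[] := wq01 v i k (query u (take k h)).
by move: (_ / _) (disc _ _ _ _) (guess_right _ _ _ _) g0 g1 => e D g g0 g1 h1 h2; nra.
Qed.

Let pointwise_wrong v (u : rand A) h :
  \sum_i guess_right (flip i v) i u h <= enorm (output u h - xs v) ^+ 2 / a ^+ 2.
Proof. by rewrite Err_sum; apply: ler_sum => i _; exact: right_flip. Qed.

Let hpm v (F : rand A -> seq O -> \bar R) : history_measurable F ->
  path_measurable N (fun (u : rand A) (zs : seq T) => F u (obs v u [::] zs)).
Proof.
move=> mF.
apply: (@path_measurable_observations _ _ _ _ _ _ _ _ T (orc v) N _ _ 0 id (fun=> [tuple])) => //.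
Qed.

Let PV v (F : rand A -> seq O -> \bar R) u := PE pi N (fun zs => F u (obs v u [::] zs)).

Let PV_ge0 v F u : (forall u h, (0 <= F u h)%E) -> (0 <= PV v F u)%E.
Proof. by move=> F0; exact: path_expectation_ge0. Qed.

Let PVD v F G u : (forall u h, (0 <= F u h)%E) -> (forall u h, (0 <= G u h)%E) ->
  history_measurable F -> history_measurable G ->
  PV v (fun u h => F u h + G u h)%E u = (PV v F u + PV v G u)%E.
Proof.
move=> F0 G0 mF mG.
apply: (@path_expectationD _ _ _ pi b c bc1 N pi _ _ (fun (u : rand A) zs => F u (obs v u [::] zs))
  (fun (u : rand A) zs => G u (obs v u [::] zs)) u) => //; exact: hpm.
Qed.

Let PVZ v F u k : 0 <= k -> (forall u h, (0 <= F u h)%E) -> history_measurable F ->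
  PV v (fun u h => k%:E * F u h)%E u = (k%:E * PV v F u)%E.
Proof.
move=> k0 F0 mF.
apply: (@path_expectationZ _ _ _ pi b c bc1 N pi _ _ (fun (u : rand A) zs => F u (obs v u [::] zs))
  u) => //; exact: hpm.
Qed.

Let hm_sum (I : Type) (r : seq I) (F : I -> rand A -> seq O -> \bar R) :
  (forall i, history_measurable (F i)) ->
  history_measurable (fun u h => \sum_(i <- r) F i u h)%E.
Proof. by move=> mF k; apply: emeasurable_sum => i; exact: mF. Qed.

Let PV_sum v (I : Type) (r : seq I) (F : I -> rand A -> seq O -> \bar R) u :
  (forall i u h, (0 <= F i u h)%E) -> (forall i, history_measurable (F i)) ->
  PV v (fun u h => \sum_(i <- r) F i u h)%E u = (\sum_(i <- r) PV v (F i) u)%E.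
Proof.
move=> F0 mF; elim: r => [|i r IH].
  rewrite big_nil -[RHS](@path_expectation_cst _ _ _ pi b c bc1 N 0); congr path_expectation.
  by apply/funext => zs; rewrite big_nil.
rewrite big_cons -IH -PVD//; last exact: hm_sum.
  by congr path_expectation; apply/funext => zs; rewrite big_cons.
by move=> u' h; apply: sume_ge0.
Qed.

Let size_obs v (u : rand A) h zs : size (obs v u h zs) = (size h + size zs)%N.
Proof.
by elim: zs h => [|z zs IH] h /=; rewrite ?addn0// IH size_rcons addSnnS.
Qed.

Let PV_le v F G u : (forall u h, (0 <= F u h)%E) -> (forall u h, (0 <= G u h)%E) ->
  history_measurable F -> history_measurable G ->
  (forall h, size h = N -> (F u h <= G u h)%E) -> (PV v F u <= PV v G u)%E.
Proof.
move=> F0 G0 mF mG FG.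
apply: (@le_path_expectation _ _ _ pi b c bc1 N pi _ _ (fun (u : rand A) zs => F u (obs v u [::] zs))
  (fun (u : rand A) zs => G u (obs v u [::] zs)) u) => //; [exact: hpm|exact: hpm|].
by move=> zs szs; apply: FG; rewrite size_obs.
Qed.

Let mErr v : history_measurable (Err v).
Proof.
move=> k; apply/measurable_EFinP.
under eq_fun do rewrite enorm_sqr dotBE.
apply: measurable_sum => i; apply: measurable_funX; apply: measurable_funB => //.
exact: mout.
Qed.

Let mPsi v i : history_measurable (Psi v i).
Proof. by move=> k; apply/measurable_EFinP; exact: mpsi. Qed.

Let mPhi v i : history_measurable (Phi v i).
Proof.
move=> k; apply/measurable_EFinP; apply: measurable_funM; last exact: mpsi.
apply: history_measurable_discount => k'.
by apply: measurable_funB => //; exact: measurable_funM.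
Qed.

Let Phi0 v i u h : (0 <= Phi v i u h)%E.
Proof.
rewrite lee_fin; apply: mulr_ge0; last by have /andP[] := psi01 v i u h.
by apply: prodr_ge0 => k _; rewrite ltW// rr_gt0.
Qed.

Let Psi0 v i u h : (0 <= Psi v i u h)%E.
Proof. by rewrite lee_fin; have /andP[] := psi01 v i u h. Qed.

Let Err0 v u h : (0 <= Err v u h)%E.
Proof. by rewrite lee_fin sqr_ge0. Qed.

Let ia2 : 0 <= (a ^+ 2)^-1.
Proof. by rewrite invr_ge0 sqr_ge0. Qed.

Let aE v (u : rand A) h : ((a ^+ 2)^-1%:E * Err v u h = (enorm (output u h - xs v) ^+ 2 / a ^+ 2)%:E)%E.
Proof. by rewrite -EFinM mulrC. Qed.

Let wrong_le v u : (\sum_i PV v (Psi (flip i v) i) u <= (a ^+ 2)^-1%:E * PV v (Err v) u)%E.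
Proof.
rewrite -PVZ// -PV_sum//.
apply: PV_le.
- by move=> u' h; apply: sume_ge0.
- by move=> u' h; rewrite mule_ge0.
- by apply: hm_sum => i; exact: mPsi.
- by move=> k; apply: measurable_funeM; exact: mErr.
- by move=> h _; rewrite sumEFin aE lee_fin pointwise_wrong.
Qed.

Let right_le v u : ((n.+1%:R * (3 / 4))%:E <=
  \sum_i PV v (Phi v i) u + (a ^+ 2)^-1%:E * PV v (Err v) u)%E.
Proof.
have mE : history_measurable (fun u h => (a ^+ 2)^-1%:E * Err v u h)%E.
  by move=> k; apply: measurable_funeM; exact: mErr.
have E0 u' h : (0 <= (a ^+ 2)^-1%:E * Err v u' h)%E by rewrite mule_ge0.
have S0 u' h : (0 <= \sum_i Phi v i u' h)%E by apply: sume_ge0.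
have mS : history_measurable (fun u h => \sum_i Phi v i u h)%E.
  by apply: hm_sum => i; exact: mPhi.
rewrite -PVZ// -PV_sum//.
rewrite -PVD// -(@path_expectation_cst _ _ _ pi b c bc1 N).
apply: (@PV_le v (fun _ _ => (n.+1%:R * (3 / 4))%:E)) => //.
- by move=> u' h; rewrite adde_ge0.
- by move=> k; apply: emeasurable_funD; [exact: mS|exact: mE].
- by move=> h hN; rewrite aE sumEFin -EFinD lee_fin; exact: pointwise_right.
Qed.

(** For each v the discounted probabilities of right guesses and the normalised
    error add up to at least 3 d / 4, and replacing the former by probabilities
    under the flipped vectors costs d / 4. Since v is summed over all sign
    vectors, the pair (flipped v, i) may be renamed (v, i): a right guess for the
    flipped sign is a wrong guess for v and is again paid for by the error. Hence
    twice the sum over v of the normalised errors is at least d / 2 times the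
    number of sign vectors. *)
Lemma assouad_sum u : ((a ^+ 2 * n.+1%:R / 4 * #|{: signs}|%:R)%:E <=
  \sum_(v : signs) PV v (Err v) u)%E.
Proof.
set S := (\sum_(v : signs) _)%E.
have S0 : (0 <= S)%E by apply: sume_ge0 => v _; exact: PV_ge0.
pose B v i := PV v (Psi (flip i v) i) u.
have E1 : (\sum_(v : signs) (n.+1%:R * (3 / 4))%:E <=
    \sum_(v : signs) (\sum_(i < n.+1) ((4^-1)%:E + B (flip i v) i) +
       (a ^+ 2)^-1%:E * PV v (Err v) u))%E.
  apply: lee_sum => v _; apply: le_trans (right_le v u) _.
  rewrite leeD2r//; apply: lee_sum => i _.
  by apply: le_trans (assouad_compare v i u) _; rewrite /B flipK.
have E2 : (\sum_(v : signs) \sum_(i < n.+1) B (flip i v) i =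
    \sum_(v : signs) \sum_(i < n.+1) B v i)%E.
  rewrite exchange_big/= [RHS]exchange_big/=; apply: eq_bigr => i _.
  by rewrite [RHS](reindex_inj (inv_inj (flipK i))).
have E3 : (\sum_(v : signs) (a ^+ 2)^-1%:E * PV v (Err v) u = (a ^+ 2)^-1%:E * S)%E.
  by rewrite -ge0_sume_distrr// => v _; exact: PV_ge0.
have E4 : (\sum_(v : signs) \sum_(i < n.+1) B v i <= (a ^+ 2)^-1%:E * S)%E.
  by rewrite -E3; apply: lee_sum => v _; exact: wrong_le.
have E5 : (\sum_(v : signs) (n.+1%:R * (3 / 4))%:E <=
   (#|{: signs}|%:R * (n.+1%:R / 4))%:E + ((a ^+ 2)^-1%:E * S + (a ^+ 2)^-1%:E * S))%E.
  apply: (le_trans E1); rewrite big_split/= E3 addeA leeD2r//.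
  under eq_bigr do rewrite big_split/=.
  rewrite big_split/= E2; apply: leeD => //.
  under eq_bigr do rewrite sumEFin sumr_const card_ord.
  by rewrite sumEFin sumr_const lee_fin !mulr_natl.
move: E5; rewrite sumEFin sumr_const.
case: S S0 {E1 E3 E4} => [s| |] //; last by move=> *; rewrite leey.
rewrite -EFinM -!EFinD !lee_fin => s0; rewrite -[_ *+ _]mulr_natl; set C := #|_|%:R => h.
have a2 : 0 < a ^+ 2 by rewrite exprn_gt0.
have : C * (n.+1%:R / 4) <= (a ^+ 2)^-1 * s by lra.
rewrite -(ler_pM2l a2) [a ^+ 2 * (_^-1 * _)]mulrA divff ?gt_eqF// mul1r; apply: le_trans.
by rewrite le_eqVlt; apply/orP; left; apply/eqP; field.
Qed.

(** If every v had a smaller error, so would their sum; but the latter is an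
    expectation over the randomness of the algorithm of the sums bounded by
    [assouad_sum]. *)
Lemma assouad : exists v : signs,
  ((a ^+ 2 * n.+1%:R / 4)%:E <=
   mean_square_error A (M := M) (orc v) N (\row_i (sgnv R v i * a))%R)%E.
Proof.
apply: contrapT => /forallNP H.
have msE v : mean_square_error A (M := M) (orc v) N (xs v) =
    (\int[rand_law A]_u PV v (Err v) u)%E.
  apply: (@path_expectation_swap _ _ _ pi b c bc1 N _ _ (rand_law A)
    (fun u zs => Err v u (obs v u [::] zs))) => //.
  exact: hpm.
have mPV v : measurable_fun setT (PV v (Err v)).
  apply: (@measurable_path_expectation_init _ _ _ pi b c bc1 N _ _
    (fun u zs => Err v u (obs v u [::] zs))) => //.
  exact: hpm.
have S : ((a ^+ 2 * n.+1%:R / 4 * #|{: signs}|%:R)%:E <=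
    \sum_(v : signs) \int[rand_law A]_u PV v (Err v) u)%E.
  rewrite -ge0_integral_sum//; last by move=> v u _; exact: PV_ge0.
  rewrite -(integral_prob_cst (rand_law A) (_%:E)).
  apply: ge0_le_integral => //.
  - move=> u _; rewrite lee_fin; have a2 := sqr_ge0 a.
    apply: mulr_ge0; last exact: ler0n.
    by apply: divr_ge0; last exact: ler0n; apply: mulr_ge0; last exact: ler0n.
  - by apply: emeasurable_sum.
  - by move=> u _; exact: assouad_sum.
have L v : (\int[rand_law A]_u PV v (Err v) u < (a ^+ 2 * n.+1%:R / 4)%:E)%E.
  by rewrite -msE ltNge; apply/negP; exact: H.
pose J v := (\int[rand_law A]_u PV v (Err v) u)%E.
have J0 v : (0 <= J v)%E by apply: integral_ge0 => u _; exact: PV_ge0.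
have Jf v : J v \is a fin_num by rewrite ge0_fin_numE// (lt_trans (L v))// ltry.
have Sf : (\sum_(v : signs) J v)%E = (\sum_(v : signs) fine (J v))%:E.
  by rewrite -sumEFin; apply: eq_bigr => v _; rewrite fineK.
move: S; rewrite -/J Sf lee_fin => S.
suff : \sum_(v : signs) fine (J v) < \sum_(v : signs) (a ^+ 2 * n.+1%:R / 4).
  by rewrite sumr_const -[X in _ < X]mulr_natr => /(le_lt_trans S); rewrite ltxx.
apply: ltr_sum => [|v _]; last by rewrite -lte_fin fineK//; exact: L.
by apply/hasP; exists [ffun=> true] => //; rewrite mem_index_enum.
Qed.

End Assouad.

(** * A bounded rational bump *)

Section RationalBump.
Variable R : realType.

(** A bounded function with slope 1 at the origin and bounded second derivative.
    Being rational, it has an explicit remainder. *)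
Definition bump (u : R) : R := u / (1 + u ^+ 2).
Definition dbump (u : R) : R := (1 - u ^+ 2) / (1 + u ^+ 2) ^+ 2.

Lemma bump_den (u : R) : 0 < 1 + u ^+ 2.
Proof. by rewrite ltr_pwDl// sqr_ge0. Qed.

Lemma bump_bound (u : R) : `|bump u| <= 2^-1.
Proof.
have d0 := bump_den u.
rewrite /bump normrM normfV (ger0_norm (ltW d0)) ler_pdivrMr//.
have := sqr_ge0 (u + 1); have := sqr_ge0 (u - 1).
by rewrite ler_norml => h1 h2; apply/andP; split; nra.
Qed.

(** The remainder is (u - w)^2 times a rational function bounded by 3/2. *)
Lemma bump_remainder (u w : R) :
  `|bump u - bump w - dbump w * (u - w)| <= 3 / 2 * (u - w) ^+ 2.
Proof.
have du := bump_den u; have dw := bump_den w.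
have -> : bump u - bump w - dbump w * (u - w) =
    (u - w) ^+ 2 * (- (2 * w + u - u * w ^+ 2) / ((1 + u ^+ 2) * (1 + w ^+ 2) ^+ 2)).
  by rewrite /bump /dbump; field; rewrite !gt_eqF.
rewrite normrM ger0_norm ?sqr_ge0// mulrC ler_wpM2r ?sqr_ge0//.
have D0 : 0 < (1 + u ^+ 2) * (1 + w ^+ 2) ^+ 2 by rewrite mulr_gt0// exprn_gt0.
rewrite normrM normfV (ger0_norm (ltW D0)) ler_pdivrMr// normrN.
apply: (le_trans (_ : _ <= `|2 * w| + `|u * (1 - w ^+ 2)|)).
  by apply: le_trans (ler_normD _ _); rewrite le_eqVlt; apply/orP; left; apply/eqP; congr `|_|; ring.
have sq (x : R) : `|x| <= (1 + x ^+ 2) / 2.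
  have := sqr_ge0 (x + 1); have := sqr_ge0 (x - 1).
  by rewrite ler_norml => h1 h2; apply/andP; split; nra.
have h1 : `|2 * w| <= 1 + w ^+ 2.
  by rewrite normrM ger0_norm//; have := sq w; lra.
have h2 := sq u.
have h3 : `|1 - w ^+ 2| <= 1 + w ^+ 2 by rewrite ler_norml; apply/andP; split; nra.
have h4 : `|u * (1 - w ^+ 2)| <= (1 + u ^+ 2) / 2 * (1 + w ^+ 2) by rewrite normrM ler_pM.
have w1 : 1 <= 1 + w ^+ 2 by rewrite lerDl sqr_ge0.
have u1 : 1 <= 1 + u ^+ 2 by rewrite lerDl sqr_ge0.
move: (1 + w ^+ 2) (1 + u ^+ 2) h1 h4 w1 u1 {h2 h3 du dw D0} => W U h1 h4 w1 u1.
apply: (le_trans (lerD h1 h4)).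
have a1 : W <= W ^+ 2 by rewrite expr2 ler_peMl// (le_trans ler01).
have : W <= U * W ^+ 2 by apply: (le_trans a1); rewrite ler_peMl ?sqr_ge0.
have : U * W <= U * W ^+ 2 by rewrite ler_wpM2l// (le_trans ler01).
lra.
Qed.

Variables (mu a : R) (mu0 : 0 < mu) (a0 : 0 < a).
(* Corrects the derivative of the bump at 1/8, which lies between 9/10 and 1. *)
Let ka : R := (dbump 8^-1)^-1.
Let B : R := 2 * mu * a * ka.

(** The bump at scale 8 a, with amplitude such that its derivative at a and - a is
    exactly 2 mu a, as the position of the minimiser demands. The scale 8 makes
    the second derivative at most mu while the height remains of order mu a^2. *)
Definition rat_eta (y : R) : R := B * (8 * a) * bump (y / (8 * a)).
Definition rat_deta (y : R) : R := B * dbump (y / (8 * a)).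

Let ka_bounds : 1 <= ka <= 10 / 9.
Proof.
have dE : dbump 8^-1 = (1 - 8^-1 ^+ 2) / (1 + 8^-1 ^+ 2) ^+ 2 by [].
have x0 : 0 <= 8^-1 ^+ 2 :> R by rewrite sqr_ge0.
have x1 : 8^-1 ^+ 2 <= 30^-1 :> R by rewrite expr2; lra.
move: (8^-1 ^+ 2) x0 x1 dE => x x0 x1 dE.
have D0 : 0 < (1 + x) ^+ 2 by rewrite exprn_gt0// ltr_pwDl.
have k0 : 0 < dbump 8^-1 by rewrite dE divr_gt0//; lra.
rewrite /ka; apply/andP; split.
  by rewrite invf_ge1// dE ler_pdivrMr//; nra.
have t0 : (0 : R) < 10 / 9 by rewrite divr_gt0.
rewrite invf_ple ?posrE//.
by rewrite dE ler_pdivlMr//; nra.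
Qed.

Let B0 : 0 < B.
Proof. by have /andP[k1 _] := ka_bounds; rewrite !mulr_gt0// (lt_le_trans ltr01). Qed.

Lemma rat_etaK (y z : R) :
  `|rat_eta y - rat_eta z - rat_deta z * (y - z)| <= mu / 2 * (y - z) ^+ 2.
Proof.
have a8 : 8 * a != 0 by rewrite gt_eqF// mulr_gt0.
have -> : rat_eta y - rat_eta z - rat_deta z * (y - z) =
  B * (8 * a) * (bump (y / (8 * a)) - bump (z / (8 * a)) -
     dbump (z / (8 * a)) * (y / (8 * a) - z / (8 * a))).
  by rewrite /rat_eta /rat_deta; field; rewrite gt_eqF.
have Ba : 0 <= B * (8 * a) by rewrite ltW// mulr_gt0// mulr_gt0.
rewrite normrM (ger0_norm Ba); apply: (le_trans (ler_wpM2l Ba (bump_remainder _ _))).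
rewrite -mulrBl exprMn.
have -> : B * (8 * a) * (3 / 2 * ((y - z) ^+ 2 * (8 * a)^-1 ^+ 2)) =
   mu * (3 / 8 * ka) * (y - z) ^+ 2.
  by rewrite /B; field; rewrite gt_eqF.
rewrite ler_wpM2r ?sqr_ge0// ler_pM2l//.
by have /andP[_ k2] := ka_bounds; lra.
Qed.

Lemma rat_eta_bound (y : R) : `|rat_eta y| <= 9 * mu * a ^+ 2.
Proof.
have Ba : 0 <= B * (8 * a) by rewrite ltW// mulr_gt0// mulr_gt0.
rewrite /rat_eta normrM (ger0_norm Ba).
apply: (le_trans (ler_wpM2l Ba (bump_bound _))).
have m0 : 0 < mu * a ^+ 2 by rewrite mulr_gt0// exprn_gt0.
have -> : B * (8 * a) / 2 = 8 * ka * (mu * a ^+ 2) by rewrite /B; field.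
rewrite -(mulrA 9) ler_pM2r//.
by have /andP[_ k2] := ka_bounds; lra.
Qed.

Lemma rat_deta_a : 2 * mu * a = rat_deta a.
Proof.
have -> : rat_deta a = B * dbump (8^-1).
  by rewrite /rat_deta; congr (_ * dbump _); field; rewrite gt_eqF.
rewrite /B /ka mulfVK//; apply: contraTneq (ka_bounds) => k0.
by rewrite /ka k0 invr0 ler10.
Qed.

Lemma rat_detaN : rat_deta (- a) = rat_deta a.
Proof. by rewrite /rat_deta /dbump mulNr sqrrN. Qed.

Lemma measurable_rat_eta : measurable_fun setT rat_eta.
Proof.
apply: measurable_funM => //.
apply: measurable_funM; first exact: measurable_funM.
apply: (measurableT_comp (@measurable_inv R)).
by apply: measurable_funD => //; apply: measurable_funX; exact: measurable_funM.
Qed.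

End RationalBump.

(** * One-point regimes *)

Section Regimes.
Variables (R : realType) (n : nat).
Notation signs := {ffun 'I_n.+1 -> bool}.
Notation d := (n.+1%:R : R).

Lemma target_flip mu eta (v : signs) i (x : 'rV[R]_n.+1) :
  target mu eta v x = target mu eta (flip i v) x - 2 * sgnv R v i * eta (x 0 i).
Proof.
rewrite /target /separable (bigD1 i)//= [in RHS](bigD1 i)//= /target_phi.
rewrite (eq_bigr (fun j => target_phi mu eta (flip i v) j (x 0 j))); last first.
  by move=> j ji; rewrite /target_phi /sgnv ffunE (negbTE ji).
set S := \sum_(_ | _) _; rewrite /sgnv flipE.
by case: (v i); rewrite /= ?expr0 ?expr1; ring.
Qed.

Lemma sgnv_sqr (v : signs) i : sgnv R v i ^+ 2 = 1.
Proof. by rewrite -real_normK ?num_real// sgnv_norm expr1n. Qed.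

(** A flip of the i-th sign is indistinguishable from a translation of the state. *)
Lemma noisy_flip (b c : {nonneg R}) (bc1 : b%:num + c%:num = 1) (c0 : 0 < c%:num)
    mu eta (cf : 'rV[R]_n.+1 -> 'rV[R]_n.+1) (v : signs) i x z t :
  dot (cf x) t = - (2 * sgnv R v i * eta (x 0 i)) ->
  @noisy R n b c bc1 c0 mu eta v cf x z =
  @noisy R n b c bc1 c0 mu eta (flip i v) cf x ((z : 'rV[R]_n.+1) + t).
Proof. by move=> E; rewrite /noisy (target_flip _ _ v i) dotDr E; ring. Qed.

(** Bernoulli's inequality: (1 + 3 / tau)^tau >= 4. *)
Lemma lazy_pow tau : (0 < tau)%N ->
  (tau%:R / (tau%:R + 3)) ^+ tau <= 4^-1 :> R.
Proof.
move=> tau0; have t0 : 0 < tau%:R :> R by rewrite ltr0n.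
have t3 : 0 < tau%:R + 3 :> R by rewrite addr_gt0.
have bern k (x : R) : 0 <= x -> 1 + k%:R * x <= (1 + x) ^+ k.
  move=> x0; elim: k => [|k IH]; first by rewrite mul0r addr0 expr0.
  rewrite exprSr; have k0 : 0 <= k%:R * x :> R by rewrite mulr_ge0.
  have p0 : 0 <= 1 + x by rewrite addr_ge0.
  by apply: le_trans (ler_wpM2r p0 IH); rewrite -natr1; nra.
have x0 : 0 <= 3 / tau%:R :> R by rewrite divr_ge0// ltW.
have := bern tau (3 / tau%:R) x0.
rewrite mulrCA divff ?gt_eqF// mulr1 => h.
have -> : tau%:R / (tau%:R + 3) = (1 + 3 / tau%:R)^-1 :> R.
  by field; rewrite !gt_eqF.
have p0 : 0 < 1 + 3 / tau%:R :> R by rewrite ltr_pwDl.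
rewrite exprVn lef_pV2 ?posrE ?exprn_gt0//; lra.
Qed.

Section OnePoint.
Variables (tau : nat) (mu sigma a : R) (N : nat) (A : one_point_algorithm R n.+1).
Hypotheses (tau0 : (0 < tau)%N) (mu0 : 0 < mu) (sigma0 : 0 < sigma) (a0 : 0 < a).
Let h : R := 9 * mu * a ^+ 2.
Let h0 : 0 < h.
Proof. by rewrite !mulr_gt0// exprn_gt0. Qed.
Notation eta := (rat_eta mu a).

Definition one_point_hard := exists (M : markov_source R)
    (F : 'rV[R]_n.+1 -> state M -> R) (xs : 'rV[R]_n.+1),
  [/\ one_point_instance tau mu sigma F, is_minimizer (objective F) xs &
      ((a ^+ 2 * d / 4)%:E <= one_point_error A F N xs)%E].

Lemma one_point_hard_of (b c : {nonneg R}) (bc1 : b%:num + c%:num = 1)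
    (c0 : 0 < c%:num) (cf : 'rV[R]_n.+1 -> 'rV[R]_n.+1)
    (t : signs -> 'I_n.+1 -> 'rV[R]_n.+1 -> 'rV[R]_n.+1) Qs :
  b%:num ^+ tau <= 4^-1 ->
  (forall i, measurable_fun setT (fun x : borel 'rV[R]_n.+1 => cf (x : 'rV[R]_n.+1) 0 i)) ->
  (forall x, 16 * dot (cf x) (cf x) <= sigma ^+ 2) ->
  (forall v i x, dot (cf x) (t v i x) = - (2 * sgnv R v i * eta (x 0 i))) ->
  (forall v i, measurable_fun setT (fun x : borel 'rV[R]_n.+1 =>
     dot (t v i (x : 'rV[R]_n.+1)) (t v i x))) ->
  b%:num = 0 \/ (forall v i, exists t0, forall x, t v i x = t0) ->
  (forall v i x, dot (t v i x) (t v i x) <= 2^-1) ->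
  (forall v x, \sum_i dot (t v i x) (t v i x) <= Qs) ->
  (1 + c%:num * N%:R) * Qs <= d / 4 ->
  one_point_hard.
Proof.
move=> btau mcf cfs cft mq tc q2 qS NQ.
have [v verr] := @assouad R n _ _ (borel 'rV[R]_n.+1) R A b c bc1 c0
  (fun v => @noisy R n b c bc1 c0 mu eta v cf) t
  (fun v => wp_measurable (noisy_well_posed bc1 c0 mu (measurable_rat_eta mu a) v mcf))
  (fun v i x z => @noisy_flip b c bc1 c0 mu _ cf v i x z _ (cft v i x)) mq tc q2 Qs qS N a a0 NQ.
exists (lazy_source (@gauss R n.+1) bc1 c0), (@noisy R n b c bc1 c0 mu eta v cf),
  (\row_i (sgnv R v i * a)); split => //.
- exact: (noisy_one_point bc1 c0 mu0 (rat_etaK mu0 a0) (measurable_rat_eta mu a) v mcf tau0 btau cfs).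
- rewrite objective_noisy; apply: (target_minimizer mu0 (rat_etaK mu0 a0)).
    exact: rat_deta_a.
  exact: rat_detaN.
Qed.

(** The noise has standard deviation sigma / 4 on a single direction, the same for
    all queries, and the translation that hides sign i depends on x_i through eta.
    Independent states allow that. Each sign then costs at most 64 h^2 / sigma^2. *)
Lemma one_point_iid :
  (1 + N%:R) * (64 * d * h ^+ 2 / sigma ^+ 2) <= d / 4 ->
  64 * h ^+ 2 / sigma ^+ 2 <= 2^-1 -> one_point_hard.
Proof.
move=> NQ q2.
have s2 : 0 < sigma ^+ 2 by rewrite exprn_gt0.
have etah y : (eta y) ^+ 2 <= h ^+ 2.
  rewrite -real_normK ?num_real// lerXn2r ?nnegrE ?(ltW h0)//.
  exact: rat_eta_bound.
pose c := (sigma / 4)^-1; have cE : sigma / 4 * c = 1.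
  by rewrite /c divff// gt_eqF// divr_gt0.
pose t (v : signs) i (x : 'rV[R]_n.+1) := (- (2 * sgnv R v i * eta (x 0 i)) * c) *: unit_row R (ord0 : 'I_n.+1).
have tE v i x : dot (t v i x) (t v i x) = 64 * (eta (x 0 i)) ^+ 2 / sigma ^+ 2.
  rewrite /t dotZl dotZr unit_row_dot mulr1.
  rewrite (_ : _ * _ = (sgnv R v i) ^+ 2 * (4 * (eta (x 0 i)) ^+ 2 * c ^+ 2)); last by ring.
  by rewrite sgnv_sqr mul1r /c; field; rewrite gt_eqF.
have tq v i x : dot (t v i x) (t v i x) <= 64 * h ^+ 2 / sigma ^+ 2.
  by rewrite tE ler_pM2r ?invr_gt0// ler_pM2l.
apply: (@one_point_hard_of 0%:nng 1%:nng (add0r _) ltr01 (fun=> (sigma / 4) *: unit_row R (ord0 : 'I_n.+1)) t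
  (64 * d * h ^+ 2 / sigma ^+ 2)).
- by rewrite /= expr0n eqn0Ngt tau0 invr_ge0.
- by [].
- move=> x; rewrite dotZl dotZr unit_row_dot mulr1.
  by rewrite le_eqVlt; apply/orP; left; apply/eqP; field.
- by move=> v i x; rewrite /t dotZl dotZr unit_row_dot mulr1 mulrCA cE mulr1.
- move=> v i; under eq_fun do rewrite tE.
  apply: measurable_funM => //; apply: measurable_funM => //; apply: measurable_funX.
  exact: (measurableT_comp (measurable_rat_eta mu a) (measurable_coord i)).
- by left.
- by move=> v i x; apply: le_trans (tq v i x) q2.
- move=> v x; apply: (@le_trans _ _ (\sum_(i < n.+1) 64 * h ^+ 2 / sigma ^+ 2)).
    by apply: ler_sum => i _; exact: tq.
  rewrite sumr_const card_ord -[leLHS]mulr_natl.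
  by rewrite le_eqVlt; apply/orP; left; apply/eqP; ring.
- by rewrite /= mul1r.
Qed.

(** A persisting state calls for translations that are constant in the query. The
    noise coefficient of coordinate i is therefore proportional to eta (x_i), at
    the price of dividing the variance among d coordinates: each sign costs
    64 d h^2 / sigma^2, but only a proportion 3 / (tau + 3) of the calls pays. *)
Lemma one_point_lazy :
  (1 + 3 / (tau%:R + 3) * N%:R) * (64 * d ^+ 2 * h ^+ 2 / sigma ^+ 2) <= d / 4 ->
  64 * d * h ^+ 2 / sigma ^+ 2 <= 2^-1 -> one_point_hard.
Proof.
move=> NQ q2.
have s2 : 0 < sigma ^+ 2 by rewrite exprn_gt0.
have d0 : 0 < d by rewrite ltr0n.
have etah y : (eta y) ^+ 2 <= h ^+ 2.
  rewrite -real_normK ?num_real// lerXn2r ?nnegrE ?(ltW h0)//.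
  exact: rat_eta_bound.
pose rd := Num.sqrt d; have rd2 : rd ^+ 2 = d by rewrite sqr_sqrtr// ltW.
have rd0 : 0 < rd by rewrite sqrtr_gt0.
pose s := sigma / (4 * h * rd); have s0 : 0 < s by rewrite divr_gt0// !mulr_gt0.
have sE : 16 * (s ^+ 2 * (d * h ^+ 2)) = sigma ^+ 2.
  by rewrite /s -rd2; field; rewrite !gt_eqF.
pose t (v : signs) i (x : 'rV[R]_n.+1) := (2 * sgnv R v i / s) *: unit_row R i.
have tE v i x : dot (t v i x) (t v i x) = 64 * d * h ^+ 2 / sigma ^+ 2.
  rewrite /t dotZl dotZr unit_row_dot mulr1.
  rewrite (_ : _ * _ = (sgnv R v i) ^+ 2 * (4 / s ^+ 2)); last by field; rewrite gt_eqF.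
  by rewrite sgnv_sqr mul1r -sE; field; rewrite !gt_eqF.
have T3 : 0 < tau%:R + 3 :> R by rewrite ltr_wpDl.
have b0 : 0 <= tau%:R / (tau%:R + 3) :> R by rewrite divr_ge0// ltW.
have c0 : 0 < 3 / (tau%:R + 3) :> R by rewrite divr_gt0.
have bc1 : tau%:R / (tau%:R + 3) + 3 / (tau%:R + 3) = 1 :> R.
  by rewrite -mulrDl divff// gt_eqF.
apply: (@one_point_hard_of (NngNum b0) (NngNum (ltW c0)) bc1 c0
  (fun x => \row_i (- s * eta (x 0 i))) t (64 * d ^+ 2 * h ^+ 2 / sigma ^+ 2)).
- exact: lazy_pow.
- move=> i; under eq_fun do rewrite mxE.
  apply: measurable_funM => //.
  exact: (measurableT_comp (measurable_rat_eta mu a) (measurable_coord i)).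
- move=> x; rewrite -sE ler_pM2l// /dot.
  apply: (@le_trans _ _ (\sum_(i < n.+1) s ^+ 2 * h ^+ 2)).
    apply: ler_sum => i _; rewrite !mxE.
    rewrite (_ : _ * _ = s ^+ 2 * (eta (x 0 i)) ^+ 2); last by ring.
    by rewrite ler_pM2l// exprn_gt0.
  rewrite sumr_const card_ord -[leLHS]mulr_natl.
  by rewrite le_eqVlt; apply/orP; left; apply/eqP; ring.
- move=> v i x; rewrite /t dotZr dot_unitr mxE; field.
  by rewrite gt_eqF.
- by move=> v i; under eq_fun do rewrite tE; exact: measurable_cst.
- by right => v i; exists (t v i 0).
- by move=> v i x; rewrite tE.
- move=> v x; under eq_bigr do rewrite tE.
  rewrite sumr_const card_ord -[leLHS]mulr_natl.
  by rewrite le_eqVlt; apply/orP; left; apply/eqP; ring.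
- exact: NQ.
Qed.

End OnePoint.
End Regimes.

(** * Projection on the plane of two queries *)


Section Projection.
Variables (R : realType) (n : nat).
Implicit Types x y z : 'rV[R]_n.+1.

Lemma dot_norm_inv x i : x 0 i / dot x x * dot x x = x 0 i.
Proof.
have [x0|x0] := eqVneq (dot x x) 0; last by rewrite mulfVK.
by rewrite (dot_eq0 x0) !mxE !mul0r.
Qed.

(** The Gram-Schmidt step. Division by zero gives zero, so that a vanishing x needs
    no separate treatment, here and below. *)
Definition ortho x y := y - (dot x y / dot x x) *: x.

Lemma dot_ortho x y : dot x (ortho x y) = 0.
Proof.
rewrite /ortho -scaleNr dotDr dotZr.
have [x0|x0] := eqVneq (dot x x) 0; last by rewrite mulNr mulfVK// subrr.
by rewrite (dot_eq0 x0) !dot0l mulr0 addr0.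
Qed.

(** The orthogonal projection of the i-th unit vector on the span of x and y: it has
    the same inner products with x and y as that vector, and is the shortest such. *)
Definition plane_proj x y i : 'rV[R]_n.+1 :=
  (x 0 i / dot x x) *: x +
  (ortho x y 0 i / dot (ortho x y) (ortho x y)) *: ortho x y.

Lemma plane_projl x y i : dot x (plane_proj x y i) = x 0 i.
Proof.
by rewrite /plane_proj dotDr !dotZr dot_ortho mulr0 addr0 dot_norm_inv.
Qed.

Lemma plane_proj_ortho x y i : dot (ortho x y) (plane_proj x y i) = ortho x y 0 i.
Proof.
rewrite /plane_proj (dotDr _ (_ *: x)) !dotZr (dotC _ x) dot_ortho mulr0 add0r.
exact: dot_norm_inv.
Qed.

Lemma plane_projr x y i : dot y (plane_proj x y i) = y 0 i.
Proof.
have E : y = ortho x y + (dot x y / dot x x) *: x by rewrite /ortho subrK.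
rewrite {1}E dotDl dotZl plane_projl plane_proj_ortho.
by rewrite [in RHS]E !mxE.
Qed.

Lemma plane_proj_dot x y i : dot (plane_proj x y i) (plane_proj x y i) =
  (x 0 i) ^+ 2 / dot x x + (ortho x y 0 i) ^+ 2 / dot (ortho x y) (ortho x y).
Proof.
rewrite {1}/plane_proj (dotDl (_ *: x)) !dotZl plane_projl plane_proj_ortho.
by congr (_ + _); rewrite expr2 mulrAC.
Qed.

Lemma sum_sqr_dot x : \sum_i (x 0 i) ^+ 2 / dot x x <= 1.
Proof.
rewrite -mulr_suml (_ : \sum_i _ = dot x x); last by apply: eq_bigr => i _; rewrite expr2.
by have [->|x0] := eqVneq (dot x x) 0; rewrite ?mul0r ?ler01// divff.
Qed.

(** The trace of a projection of rank at most two. *)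
Lemma plane_proj_sum x y :
  \sum_i dot (plane_proj x y i) (plane_proj x y i) <= 2.
Proof.
under eq_bigr do rewrite plane_proj_dot.
by rewrite big_split/= -[2]/(1 + 1) lerD ?sum_sqr_dot.
Qed.

Lemma plane_proj_le2 x y i : dot (plane_proj x y i) (plane_proj x y i) <= 2.
Proof.
apply: le_trans (plane_proj_sum x y); rewrite (bigD1 i)//= lerDl.
by apply: sumr_ge0 => j _; exact: dot_ge0.
Qed.

Lemma measurable_dot2 dP (P : measurableType dP) (f g : P -> 'rV[R]_n.+1) :
  (forall i, measurable_fun setT (fun p => f p 0 i)) ->
  (forall i, measurable_fun setT (fun p => g p 0 i)) ->
  measurable_fun setT (fun p => dot (f p) (g p)).
Proof. by move=> mf mg; apply: measurable_sum => i; exact: measurable_funM. Qed.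

Lemma measurable_div dP (P : measurableType dP) (f g : P -> R) :
  measurable_fun setT f -> measurable_fun setT g ->
  measurable_fun setT (fun p => f p / g p).
Proof.
move=> mf mg; apply: measurable_funM => //.
exact: (measurableT_comp (@measurable_inv R)).
Qed.

Lemma measurable_plane_proj dP (P : measurableType dP) (f g : P -> 'rV[R]_n.+1) i :
  (forall i, measurable_fun setT (fun p => f p 0 i)) ->
  (forall i, measurable_fun setT (fun p => g p 0 i)) ->
  measurable_fun setT (fun p =>
    dot (plane_proj (f p) (g p) i) (plane_proj (f p) (g p) i)).
Proof.
move=> mf mg; under eq_fun do rewrite plane_proj_dot.
have mo j : measurable_fun setT (fun p => ortho (f p) (g p) 0 j).
  under eq_fun do rewrite !mxE.
  apply: measurable_funB => //; apply: measurable_funM => //.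
  by apply: measurable_div; exact: measurable_dot2.
by apply: measurable_funD; apply: measurable_div; first [exact: measurable_funX|exact: measurable_dot2].
Qed.

End Projection.

(** * Two-point regimes *)

Section TwoPointRegimes.
Variables (R : realType) (n : nat).
Notation signs := {ffun 'I_n.+1 -> bool}.
Notation d := (n.+1%:R : R).
Variables (tau : nat) (mu sigma a : R) (N : nat) (A : two_point_algorithm R n.+1).
Hypotheses (tau0 : (0 < tau)%N) (mu0 : 0 < mu) (sigma0 : 0 < sigma) (a0 : 0 < a).
Let be : R := 2 * mu * a.
Let be0 : 0 < be.
Proof. by rewrite !mulr_gt0. Qed.
Let d0 : 0 < d.
Proof. by rewrite ltr0n. Qed.
Let s : R := sigma / (4 * Num.sqrt d).
Let s0 : 0 < s.
Proof. by rewrite divr_gt0// mulr_gt0// sqrtr_gt0. Qed.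
Let sE : 16 * s ^+ 2 * d = sigma ^+ 2.
Proof.
have rd2 : Num.sqrt d ^+ 2 = d by rewrite sqr_sqrtr// ltW.
have rd0 : Num.sqrt d != 0 by rewrite gt_eqF// sqrtr_gt0.
by rewrite -[in LHS]rd2 /s; field.
Qed.

Definition two_point_hard := exists (M : markov_source R)
    (F : 'rV[R]_n.+1 -> state M -> R) (xs : 'rV[R]_n.+1),
  [/\ two_point_instance tau mu sigma F, is_minimizer (objective F) xs &
      ((a ^+ 2 * d / 4)%:E <= two_point_error A F N xs)%E].

(** The two answers involve the state only through its inner products with the two
    query points, so the flip of sign i is hidden by any translation parallel to a
    vector p i that has the inner products of the i-th unit vector with both
    points. Its cost is proportional to the squared norm of p i. *)
Lemma two_point_hard_of (b c : {nonneg R}) (bc1 : b%:num + c%:num = 1)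
    (c0 : 0 < c%:num)
    (p : 'I_n.+1 -> 'rV[R]_n.+1 * 'rV[R]_n.+1 -> 'rV[R]_n.+1) (P : R) :
  b%:num ^+ tau <= 4^-1 ->
  (forall i xy, dot xy.1 (p i xy) = xy.1 0 i /\ dot xy.2 (p i xy) = xy.2 0 i) ->
  (forall i, measurable_fun setT
    (fun xy : borel 'rV[R]_n.+1 * borel 'rV[R]_n.+1 => dot (p i xy) (p i xy))) ->
  b%:num = 0 \/ (forall i, exists p0, forall xy, p i xy = p0) ->
  (forall i xy, dot (p i xy) (p i xy) <= 2) ->
  (forall xy, \sum_i dot (p i xy) (p i xy) <= P) ->
  128 * d * be ^+ 2 / sigma ^+ 2 <= 2^-1 ->
  (1 + c%:num * N%:R) * (64 * d * be ^+ 2 / sigma ^+ 2 * P) <= d / 4 ->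
  two_point_hard.
Proof.
move=> btau px mp pc p2 pP q2 NQ.
pose t (v : signs) i xy := (- (2 * sgnv R v i * be) / s) *: p i xy.
have s2 : 0 < sigma ^+ 2 by rewrite exprn_gt0.
have tE v i xy : dot (t v i xy) (t v i xy) =
    64 * d * be ^+ 2 / sigma ^+ 2 * dot (p i xy) (p i xy).
  rewrite /t dotZl dotZr mulrA; congr (_ * _).
  rewrite (_ : _ * _ = (sgnv R v i) ^+ 2 * (4 * be ^+ 2 / s ^+ 2)); last first.
    by field; rewrite gt_eqF.
  by rewrite sgnv_sqr mul1r -sE; field; rewrite !gt_eqF.
have K0 : 0 <= 64 * d * be ^+ 2 / sigma ^+ 2.
  by rewrite divr_ge0 ?sqr_ge0// mulr_ge0 ?sqr_ge0// mulr_ge0// ltW.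
pose F v := @noisy R n b c bc1 c0 mu (lin_eta be) v (lin_cf s).
have Fflip v i x z tt : dot x tt = - (2 * sgnv R v i * be) / s * x 0 i ->
    F v x z = F (flip i v) x ((z : 'rV[R]_n.+1) + tt).
  move=> E; apply: noisy_flip; rewrite /lin_cf /lin_eta dotZl E.
  by field; rewrite gt_eqF.
have mF v : measurable_fun setT (fun q : borel 'rV[R]_n.+1 * borel 'rV[R]_n.+1 =>
    F v q.1 q.2).
  exact: (wp_measurable (noisy_well_posed bc1 c0 mu (measurable_lin_eta be) v
    (measurable_lin_cf s))).
pose orc v (xy : borel 'rV[R]_n.+1 * borel 'rV[R]_n.+1) (z : borel 'rV[R]_n.+1) :=
  (F v xy.1 z, F v xy.2 z) : (R * R)%type.
have morc v : measurable_fun setT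
    (fun q : (borel 'rV[R]_n.+1 * borel 'rV[R]_n.+1) * borel 'rV[R]_n.+1 => orc v q.1 q.2).
  apply: measurable_fun_pair.
    apply: (measurableT_comp (mF v) (_ : measurable_fun setT (fun q :
      (borel 'rV[R]_n.+1 * borel 'rV[R]_n.+1) * borel 'rV[R]_n.+1 => (q.1.1, q.2)))).
    by apply: measurable_fun_pair => //; exact: measurableT_comp.
  apply: (measurableT_comp (mF v) (_ : measurable_fun setT (fun q :
    (borel 'rV[R]_n.+1 * borel 'rV[R]_n.+1) * borel 'rV[R]_n.+1 => (q.1.2, q.2)))).
  by apply: measurable_fun_pair => //; exact: measurableT_comp.
have orcE v i xy z : orc v xy z = orc (flip i v) xy ((z : 'rV[R]_n.+1) + t v i xy).
  have [p1 p2'] := px i xy.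
  by rewrite /orc (@Fflip v i xy.1 z (t v i xy)) ?(@Fflip v i xy.2 z (t v i xy))//
    /t dotZr ?p1 ?p2'.
have mq v i : measurable_fun setT (fun xy : borel 'rV[R]_n.+1 * borel 'rV[R]_n.+1 =>
    dot (t v i xy) (t v i xy)).
  by under eq_fun do rewrite tE; exact: measurable_funM.
have tc : b%:num = 0 \/ (forall v i, exists t0, forall xy, t v i xy = t0).
  case: pc => [->|pc]; [by left|right=> v i]; have [p0 p0E] := pc i.
  by exists ((- (2 * sgnv R v i * be) / s) *: p0) => xy; rewrite /t p0E.
have tq v i xy : dot (t v i xy) (t v i xy) <= 2^-1.
  rewrite tE; apply: le_trans q2; apply: (le_trans (ler_wpM2l K0 (p2 _ _))).
  by rewrite le_eqVlt; apply/orP; left; apply/eqP; ring.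
have qS v xy : \sum_i dot (t v i xy) (t v i xy) <= 64 * d * be ^+ 2 / sigma ^+ 2 * P.
  under eq_bigr do rewrite tE.
  by rewrite -mulr_sumr ler_wpM2l.
have [v verr] := @assouad R n _ _ _ _ A b c bc1 c0 orc t morc orcE mq tc tq _ qS N a a0 NQ.
exists (lazy_source (@gauss R n.+1) bc1 c0), (F v), (\row_i (sgnv R v i * a)); split => //.
- by apply: noisy_two_point => //; rewrite sE.
- rewrite objective_noisy.
  exact: (@target_minimizer R n mu mu0 (lin_eta be) (fun=> be) (lin_etaK mu0 be)).
Qed.

(** With independent states p i may depend on the queries, and the projection on
    their span is the cheapest choice: all signs together cost no more than two
    unit vectors. *)
Lemma two_point_iid :
  (1 + N%:R) * (128 * d * be ^+ 2 / sigma ^+ 2) <= d / 4 ->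
  128 * d * be ^+ 2 / sigma ^+ 2 <= 2^-1 -> two_point_hard.
Proof.
move=> NQ q2.
apply: (@two_point_hard_of 0%:nng 1%:nng (add0r _) ltr01
  (fun i xy => plane_proj xy.1 xy.2 i) 2) => //.
- by rewrite /= expr0n eqn0Ngt tau0 invr_ge0.
- by move=> i xy; rewrite plane_projl plane_projr.
- move=> i; apply: measurable_plane_proj => j.
    exact: (measurableT_comp (@measurable_coord R n.+1 j)).
  exact: (measurableT_comp (@measurable_coord R n.+1 j)).
- by left.
- by move=> i xy; exact: plane_proj_le2.
- by move=> xy; exact: plane_proj_sum.
- rewrite /= mul1r; apply: le_trans NQ; rewrite ler_wpM2l ?addr_ge0//.
  by rewrite le_eqVlt; apply/orP; left; apply/eqP; ring.
Qed.

(** With a persisting state p i has to be constant, hence the unit vector itself; the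
    d signs cost d, but only a proportion 3 / (tau + 3) of the calls pays. *)
Lemma two_point_lazy :
  (1 + 3 / (tau%:R + 3) * N%:R) * (64 * d ^+ 2 * be ^+ 2 / sigma ^+ 2) <= d / 4 ->
  128 * d * be ^+ 2 / sigma ^+ 2 <= 2^-1 -> two_point_hard.
Proof.
move=> NQ q2.
have T3 : 0 < tau%:R + 3 :> R by rewrite ltr_wpDl.
have b0 : 0 <= tau%:R / (tau%:R + 3) :> R by rewrite divr_ge0// ltW.
have c0 : 0 < 3 / (tau%:R + 3) :> R by rewrite divr_gt0.
have bc1 : tau%:R / (tau%:R + 3) + 3 / (tau%:R + 3) = 1 :> R.
  by rewrite -mulrDl divff// gt_eqF.
apply: (@two_point_hard_of (NngNum b0) (NngNum (ltW c0)) bc1 c0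
  (fun i _ => unit_row R i) d) => //.
- exact: lazy_pow.
- by move=> i xy; rewrite !dot_unitr.
- by right => i; exists (unit_row R i).
- by move=> i xy; rewrite unit_row_dot ler1n.
- move=> xy; under eq_bigr do rewrite unit_row_dot.
  by rewrite sumr_const card_ord.
- apply: le_trans NQ; rewrite ler_wpM2l//.
  by rewrite le_eqVlt; apply/orP; left; apply/eqP; ring.
Qed.

End TwoPointRegimes.

(** * Choice of the constants *)

Section Budget.
Variable R : realType.

(** With a^2 = 5 eps / d the height of the bump is 9 mu a^2 = 45 mu eps / d, so this
    constant times (mu eps / sigma)^2 is 64 d^2 h^2 / sigma^2. The two-point
    regimes have smaller constants, at most 64 * 40. *)
Definition noise_const : R := 64 * (9 * 5) ^+ 2.
Notation K := noise_const.

Lemma noise_const_gt0 : 0 < K.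
Proof. by rewrite mulr_gt0// exprn_gt0// mulr_gt0. Qed.

Lemma noise_const_ge : 64 * 40 <= K.
Proof. by rewrite ler_pM2l//; lra. Qed.

(** The universal constant of the theorem. The factor 48 = 8 * 3 * 2 lets all calls
    but the first spend at most d / 8, accounts for the refresh probability, at
    most 3 / tau, and for d + tau <= 2 max (d, tau). *)
Definition query_rate : R := (48 * K)^-1.
(** The threshold for (mu eps / sigma)^2, respectively mu^2 eps / sigma^2, below
    which eps counts as small: the first call, which always meets a fresh state,
    then costs at most d / 8. *)
Definition noise_ratio : R := (8 * K)^-1.

Lemma query_rate_gt0 : 0 < query_rate.
Proof. by rewrite invr_gt0 mulr_gt0// noise_const_gt0. Qed.

Lemma noise_ratio_gt0 : 0 < noise_ratio.
Proof. by rewrite invr_gt0 mulr_gt0// noise_const_gt0. Qed.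

Lemma noise_ratio_le1 : noise_ratio <= 1.
Proof.
rewrite /noise_ratio invf_le1 ?mulr_gt0 ?noise_const_gt0//.
by have := noise_const_ge; lra.
Qed.

Lemma budget_le (d w N B q : R) : 0 <= w -> 0 <= q -> N <= B ->
  q <= d / 8 -> w * B * q <= d / 8 -> (1 + w * N) * q <= d / 4.
Proof.
move=> w0 q0 NB qd wBq.
have : w * N * q <= w * B * q by rewrite ler_wpM2r// ler_wpM2l.
rewrite mulrDl mul1r; lra.
Qed.

Section Params.
Variables (n tau : nat) (mu sigma eps : R).
Hypotheses (tau0 : (0 < tau)%N) (mu0 : 0 < mu) (sigma0 : 0 < sigma) (eps0 : 0 < eps).
Notation d := (n.+1%:R : R).
Notation a := (Num.sqrt (5 * eps / d)).

Lemma separation_sqr : a ^+ 2 = 5 * eps / d.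
Proof. by rewrite sqr_sqrtr// divr_ge0// mulr_ge0// ltW. Qed.

Lemma separation_gt0 : 0 < a.
Proof. by rewrite sqrtr_gt0 divr_gt0// mulr_gt0. Qed.

Lemma lazy_weight : 3 / (tau%:R + 3) <= 3 / tau%:R :> R.
Proof.
have t0 : 0 < tau%:R :> R by rewrite ltr0n.
by rewrite ler_pM2l// lef_pV2 ?posrE ?addr_gt0// lerDl.
Qed.

Lemma error_gt_eps : eps < a ^+ 2 * d / 4.
Proof.
rewrite separation_sqr (_ : _ / 4 = 5 / 4 * eps); last by field; rewrite gt_eqF.
by move: eps0 => e0; lra.
Qed.

Lemma one_point_hard_budget (N : nat) (A : one_point_algorithm R n.+1) :
  mu ^+ 2 * eps ^+ 2 / sigma ^+ 2 <= noise_ratio ->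
  N%:R <= query_rate * (d * (n.+1 + tau)%:R * sigma ^+ 2 / (mu ^+ 2 * eps ^+ 2)) ->
  one_point_hard tau mu sigma a N A.
Proof.
have K0 := noise_const_gt0; have a0 := separation_gt0.
have t0 : 0 < tau%:R :> R by rewrite ltr0n.
have d1 : 1 <= d by rewrite ler1n.
have d0 : 0 < d by rewrite ltr0n.
pose X : R := mu ^+ 2 * eps ^+ 2 / sigma ^+ 2; rewrite -/X.
have X0 : 0 < X by rewrite divr_gt0 ?mulr_gt0 ?exprn_gt0.
have -> : d * (n.+1 + tau)%:R * sigma ^+ 2 / (mu ^+ 2 * eps ^+ 2) =
    d * (d + tau%:R) / X.
  by rewrite natrD /X; field; rewrite !gt_eqF.
move=> Xr NB.
have KX : K * X <= 1 / 8.
  by rewrite -ler_pdivlMl// (le_trans Xr)// /noise_ratio invfM mul1r mulrC.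
have hE : 9 * mu * a ^+ 2 = (9 * 5) * (mu * eps / d) by rewrite separation_sqr; ring.
have [dt|td] := ltnP n.+1 tau.
- have dt' : d <= tau%:R by rewrite ler_nat ltnW.
  apply: one_point_lazy => //; rewrite hE.
    rewrite (_ : 64 * d ^+ 2 * _ / _ = K * X); last by rewrite /noise_const /X; field; rewrite !gt_eqF.
    apply: (budget_le _ _ NB); [|by rewrite ltW// mulr_gt0|by lra|].
      by rewrite divr_ge0// addr_ge0.
    apply: (@le_trans _ _ (3 / tau%:R * (query_rate * (d * (2 * tau%:R) / X)) * (K * X))).
      rewrite ler_wpM2r//; first by rewrite ltW// mulr_gt0.
      apply: ler_pM.
      - by rewrite divr_ge0// addr_ge0.
      - by rewrite ltW// mulr_gt0 ?query_rate_gt0// divr_gt0// mulr_gt0// addr_gt0.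
      - exact: lazy_weight.
      - rewrite ler_pM2l ?query_rate_gt0// ler_pM2r ?invr_gt0// ler_pM2l//; lra.
    rewrite le_eqVlt; apply/orP; left; apply/eqP; rewrite /query_rate.
    by field; rewrite !gt_eqF.
  rewrite (_ : 64 * d * _ / _ = K * X / d); last by rewrite /noise_const /X; field; rewrite !gt_eqF.
  by rewrite ler_pdivrMr//; lra.
- have td' : tau%:R <= d by rewrite ler_nat.
  apply: one_point_iid => //; rewrite hE.
    rewrite (_ : 64 * d * _ / _ = K * X / d); last by rewrite /noise_const /X; field; rewrite !gt_eqF.
    rewrite -(mul1r N%:R); apply: (budget_le _ _ NB) => //.
    - by rewrite ltW// divr_gt0// mulr_gt0.
    - by rewrite ler_pdivrMr//; nra.
    rewrite mul1r.
    apply: (@le_trans _ _ ((query_rate * (d * (2 * d) / X)) * (K * X / d))).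
      rewrite ler_wpM2r//; first by rewrite ltW// divr_gt0// mulr_gt0.
      rewrite ler_pM2l ?query_rate_gt0// ler_pM2r ?invr_gt0// ler_pM2l//; lra.
    apply: (@le_trans _ _ (d / 24)); last by lra.
    rewrite le_eqVlt; apply/orP; left; apply/eqP; rewrite /query_rate.
    by field; rewrite !gt_eqF.
  rewrite (_ : 64 * _ / _ = K * X / d ^+ 2); last by rewrite /noise_const /X; field; rewrite !gt_eqF.
  by rewrite ler_pdivrMr ?exprn_gt0//; nra.
Qed.

Lemma two_point_hard_budget (N : nat) (A : two_point_algorithm R n.+1) :
  mu ^+ 2 * eps / sigma ^+ 2 <= noise_ratio ->
  N%:R <= query_rate * ((n.+1 + tau)%:R * sigma ^+ 2 / (mu ^+ 2 * eps)) ->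
  two_point_hard tau mu sigma a N A.
Proof.
have K0 := noise_const_gt0; have a0 := separation_gt0.
have t0 : 0 < tau%:R :> R by rewrite ltr0n.
have d1 : 1 <= d by rewrite ler1n.
have d0 : 0 < d by rewrite ltr0n.
pose Y : R := mu ^+ 2 * eps / sigma ^+ 2; rewrite -/Y.
have Y0 : 0 < Y by rewrite divr_gt0 ?mulr_gt0 ?exprn_gt0.
have -> : (n.+1 + tau)%:R * sigma ^+ 2 / (mu ^+ 2 * eps) = (d + tau%:R) / Y.
  by rewrite natrD /Y; field; rewrite !gt_eqF.
move=> Yr NB.
have KY : K * Y <= 1 / 8.
  by rewrite -ler_pdivlMl// (le_trans Yr)// /noise_ratio invfM mul1r mulrC.
have Y64 : 64 * 40 * Y <= K * Y by rewrite ler_pM2r// noise_const_ge.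
have bE : (2 * mu * a) ^+ 2 = 4 * mu ^+ 2 * (5 * eps / d) by rewrite exprMn separation_sqr; ring.
have q2 : 128 * d * (2 * mu * a) ^+ 2 / sigma ^+ 2 <= 2^-1.
  rewrite bE (_ : _ / _ = 64 * 40 * Y); last by rewrite /Y; field; rewrite !gt_eqF.
  by lra.
have [dt|td] := ltnP n.+1 tau.
- have dt' : d <= tau%:R by rewrite ler_nat ltnW.
  apply: two_point_lazy => //; rewrite bE.
  rewrite (_ : 64 * d ^+ 2 * _ / _ = 64 * 20 * Y * d); last by rewrite /Y; field; rewrite !gt_eqF.
  apply: (@le_trans _ _ ((1 + 3 / (tau%:R + 3) * N%:R) * (K * Y * d))).
    apply: ler_wpM2l; first by rewrite addr_ge0// mulr_ge0// divr_ge0// addr_ge0.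
    by rewrite ler_pM2r//; lra.
  apply: (budget_le _ _ NB); [|by rewrite ltW// (mulr_gt0 (mulr_gt0 K0 Y0) d0)|by nra|].
    by rewrite divr_ge0// addr_ge0.
  apply: (@le_trans _ _ (3 / tau%:R * (query_rate * ((2 * tau%:R) / Y)) * (K * Y * d))).
    rewrite ler_wpM2r//; first by rewrite ltW// (mulr_gt0 (mulr_gt0 K0 Y0) d0).
    apply: ler_pM.
    - by rewrite divr_ge0// addr_ge0.
    - by rewrite ltW// mulr_gt0 ?query_rate_gt0// divr_gt0// addr_gt0.
    - exact: lazy_weight.
    - rewrite ler_pM2l ?query_rate_gt0// ler_pM2r ?invr_gt0//; lra.
  rewrite le_eqVlt; apply/orP; left; apply/eqP; rewrite /query_rate.
  by field; rewrite !gt_eqF.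
- have td' : tau%:R <= d by rewrite ler_nat.
  apply: two_point_iid => //; rewrite bE.
  rewrite (_ : 128 * d * _ / _ = 64 * 40 * Y); last by rewrite /Y; field; rewrite !gt_eqF.
  apply: (@le_trans _ _ ((1 + 1 * N%:R) * (K * Y))).
    by rewrite mul1r ler_wpM2l ?addr_ge0.
  apply: (budget_le _ _ NB) => //; [by rewrite ltW// (mulr_gt0 K0 Y0)|by lra|].
  rewrite mul1r.
  apply: (@le_trans _ _ ((query_rate * ((2 * d) / Y)) * (K * Y))).
    rewrite ler_wpM2r//; first by rewrite ltW// mulr_gt0.
    rewrite ler_pM2l ?query_rate_gt0// ler_pM2r ?invr_gt0//; lra.
  apply: (@le_trans _ _ (d / 24)); last by lra.
  rewrite le_eqVlt; apply/orP; left; apply/eqP; rewrite /query_rate.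
  by field; rewrite !gt_eqF.
Qed.

End Params.
End Budget.
Theorem theorem2 (R : realType) :
  exists2 c : R, 0 < c &
  forall (d tau : nat) (mu sigma1 sigma2 : R),
    (1 <= d)%N -> (1 <= tau)%N -> 0 < mu -> 0 < sigma1 -> 0 < sigma2 ->
  exists2 eps0 : R, 0 < eps0 &
  forall eps : R, 0 < eps -> eps <= eps0 ->
    (forall (N : nat) (A : one_point_algorithm R d),
       exists (M : markov_source R) (F : 'rV[R]_d -> state M -> R)
         (xs : 'rV[R]_d),
         [/\ one_point_instance tau mu sigma1 F,
             is_minimizer (objective F) xs &
             (one_point_error A F N xs <= eps%:E)%E ->
             c * (d%:R * (d + tau)%:R * sigma1 ^+ 2 / (mu ^+ 2 * eps ^+ 2))
             <= N%:R])
    /\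
    (forall (N : nat) (A : two_point_algorithm R d),
       exists (M : markov_source R) (F : 'rV[R]_d -> state M -> R)
         (xs : 'rV[R]_d),
         [/\ two_point_instance tau mu sigma2 F,
             is_minimizer (objective F) xs &
             (two_point_error A F N xs <= eps%:E)%E ->
             c * ((d + tau)%:R * sigma2 ^+ 2 / (mu ^+ 2 * eps))
             <= N%:R]).
Proof.
exists (query_rate R); first exact: query_rate_gt0.
move=> [//|n] tau mu s1 s2 _ tau0 mu0 s10 s20.
have r0 := noise_ratio_gt0 R; have r1 := noise_ratio_le1 R.
exists (noise_ratio R * Num.min (s1 / mu) (s2 ^+ 2 / mu ^+ 2)).
  by rewrite mulr_gt0// lt_min !divr_gt0 ?exprn_gt0.
move=> eps e0 epsle.
have e1 : mu * eps / s1 <= noise_ratio R.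
  rewrite ler_pdivrMr// mulrC -ler_pdivlMr// -mulrA.
  by apply: (le_trans epsle); rewrite ler_pM2l// ge_min lexx.
have e2 : mu ^+ 2 * eps / s2 ^+ 2 <= noise_ratio R.
  rewrite ler_pdivrMr ?exprn_gt0// mulrC -ler_pdivlMr ?exprn_gt0// -mulrA.
  by apply: (le_trans epsle); rewrite ler_pM2l// ge_min lexx orbT.
have e1' : mu ^+ 2 * eps ^+ 2 / s1 ^+ 2 <= noise_ratio R.
  have x0 : 0 <= mu * eps / s1 by rewrite ltW// divr_gt0// mulr_gt0.
  rewrite (_ : _ / _ = (mu * eps / s1) ^+ 2); last by field; rewrite gt_eqF.
  by apply: (le_trans _ e1); rewrite expr2 ler_piMl//; exact: le_trans e1 r1.
split=> N A.
- set B := query_rate R * _; have B0 : 0 <= B.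
    apply: mulr_ge0; first exact: ltW (query_rate_gt0 R).
    by apply: divr_ge0; apply: mulr_ge0; rewrite ?sqr_ge0.
  (* Above the bound any instance will do, for example the one for no call at all;
     below it the error of the hard instance exceeds eps. *)
  have [BN|NB] := leP B N%:R.
    have [|M [F [xs [Fi Fm _]]]] := one_point_hard_budget (N := 0) tau0 mu0 s10 e0 A e1'.
      exact: B0.
    by exists M, F, xs.
  have [M [F [xs [Fi Fm err]]]] := one_point_hard_budget tau0 mu0 s10 e0 A e1' (ltW NB).
  exists M, F, xs; split => // le_eps.
  by have := le_trans err le_eps; rewrite lee_fin leNgt error_gt_eps.
- set B := query_rate R * _; have B0 : 0 <= B.
    apply: mulr_ge0; first exact: ltW (query_rate_gt0 R).
    by apply: divr_ge0; apply: mulr_ge0; rewrite ?sqr_ge0// ltW.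
  have [BN|NB] := leP B N%:R.
    have [|M [F [xs [Fi Fm _]]]] := two_point_hard_budget (N := 0) tau0 mu0 s20 e0 A e2.
      exact: B0.
    by exists M, F, xs.
  have [M [F [xs [Fi Fm err]]]] := two_point_hard_budget tau0 mu0 s20 e0 A e2 (ltW NB).
  exists M, F, xs; split => // le_eps.
  by have := le_trans err le_eps; rewrite lee_fin leNgt error_gt_eps.
Qed.
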